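(* Let $\{c_k\}_{k=1}^{\infty}$ be a nonnegative sequence of real numbers belonging to the class RBVS. Then: (i) if $\alpha$ is an even natural number, then the series $\sum_{k=1}^{\infty}c_k\sin (k^{\alpha} x)$ converges at the point $x=\frac{\pi}{2}$ or at the point $x=\frac{2\pi}{3}$ only if $\sum_{k=1}^{\infty}c_k<\infty$ (that is, convergence at either one of these two points implies $\sum_{k=1}^\infty c_k<\infty$); (ii) if $\alpha$ is an odd natural number and $f$ is a polynomial of degree $\alpha$ with rational coefficients containing only odd powers of the variable, then for uniform convergence of the series $\sum_{k=1}^{\infty}c_k\sin (f(k) x)$ in $x\in\mathbb{R}$ it is sufficient that $c_kk\to 0$ as $k\to\infty$; (iii) if $\alpha$ is an even natural number and $E\subset\mathbb{R}$ is a set containing a point of the form $\frac{\pi}{2}+2\pi m$ or $\frac{2\pi}{3}+2\pi m$ with $m\in \mathbb{Z}$, then the series $\sum_{k=1}^{\infty}c_k\sin (k^{\alpha} x)$ converges uniformly on $E$ if and only if $\sum_{k=1}^{\infty}c_k<\infty$; (iv) if $\alpha$ is an odd natural number and $E\subset\mathbb{R}$ is a set containing, for some $\gamma\geq 2$, a discrete $(\alpha,\gamma)$-neighbourhood of zero, then the series $\sum_{k=1}^{\infty}c_k\sin (k^{\alpha} x)$ converges uniformly on $E$ if and only if $c_kk\to 0$ as $k\to\infty$.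
   Context: Natural numbers are the positive integers. A sequence $\{c_k\}_{k=1}^\infty$ belongs to the class RBVS if $c_k\to 0$ as $k\to\infty$ and there is a constant $V$, depending only on $\{c_k\}$, such that $\sum_{k=l}^{\infty}|c_k-c_{k+1}|\leq Vc_l$ for every $l\ge 1$. A polynomial $f$ of odd degree $\alpha$ with rational coefficients in odd powers is one of the form $f(k)=\sum_{1\le j\le \alpha,\ j\text{ odd}} q_j k^j$ with $q_j\in\mathbb{Q}$ and $q_\alpha\ne 0$. For real $\alpha>0$ and $\gamma>0$, a discrete $(\alpha,\gamma)$-neighbourhood of zero is a sequence $\{x_j\}_{j=0}^{\infty}$ of real numbers such that, for some $N\in\mathbb{N}$, $|x_j|=\frac{\pi}{\gamma^{\alpha+1}(N+j)^{\alpha}}$ for all integers $j\ge 0$ (the signs of the $x_j$ are arbitrary); a set contains it if it contains all the points $x_j$. Uniform convergence on a set means uniform convergence of the partial sums $\sum_{k=1}^{L}$ in $x$ on that set as $L\to\infty$. *)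

(* Defs.v *)
From mathcomp Require Import all_boot all_order all_algebra.
From mathcomp Require Import all_classical all_reals all_analysis.

Set Implicit Arguments.
Unset Strict Implicit.
Unset Printing Implicit Defensive.

Import Order.TTheory GRing.Theory Num.Theory.
Import numFieldNormedType.Exports.

Local Open Scope classical_set_scope.
Local Open Scope ring_scope.

(* A sequence {c_k}_{k >= 1} is represented by c : nat -> R; the value c 0 is
   junk and is never used: every sum and every hypothesis starts at index 1. *)

(* The infinite sum is a sum of nonnegative terms in \bar R, so the bound by
   the real number V * c l includes its convergence. *)
Definition RBVS (R : realType) (c : nat -> R) : Prop :=
  c k @[k --> \oo] --> (0 : R) /\
  exists V : R, forall l : nat, (1 <= l)%N ->
    (\sum_(l <= k <oo) (`|c k - c k.+1|)%:E <= (V * c l)%:E)%E.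

Definition sin_psum (R : realType) (c f : nat -> R) (L : nat) (x : R) : R :=
  \sum_(1 <= k < L.+1) c k * sin (f k * x).

Definition sin_series_ucvg (R : realType) (c f : nat -> R) (E : set R) : Prop :=
  exists g : R -> R, {uniform E, sin_psum c f @ \oo --> g}.

(* For c nonnegative on indices k >= 1. *)
Definition summable_from1 (R : realType) (c : nat -> R) : Prop :=
  (\sum_(1 <= k <oo) (c k)%:E < +oo)%E.

(* size q = alpha.+1 says that q has degree exactly alpha. *)
Definition odd_powers_of_degree (alpha : nat) (q : {poly rat}) : Prop :=
  size q = alpha.+1 /\ forall j : nat, ~~ odd j -> q`_j = 0.

(* Meant for 0 < alpha and 0 < gamma; the signs of the x j are arbitrary. *)
Definition discrete_nbhd0 (R : realType) (alpha gamma : R) (x : nat -> R)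
    : Prop :=
  exists N : nat, (1 <= N)%N /\ forall j : nat,
    `|x j| = pi / (gamma `^ (alpha + 1) * (N + j)%:R `^ alpha).

(* Main.v *)
Require Import Defs.
From mathcomp Require Import all_boot all_order all_algebra.
From mathcomp Require Import all_classical all_reals all_analysis.
From mathcomp Require Import ring lra zify.
Import Order.TTheory GRing.Theory Num.Theory.
Import numFieldNormedType.Exports.
Local Open Scope ring_scope.

Set Implicit Arguments.
Unset Strict Implicit.
Unset Printing Implicit Defensive.

(** Parts (i) and (iii) are arithmetic. For even alpha the residue of k^alpha
    is 0 or 1 modulo 4 and modulo 3, according to whether k is divisible by 2,
    respectively 3. At pi/2 and 2pi/3 the series is therefore, up to a positive
    factor, the sum of c_k over the k that are not multiples of p = 2 or p = 3.
    A sequence of class RBVS is almost decreasing, so the omitted terms are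
    dominated by their predecessors ([sum_le_nonmultiples]).

    The necessity half of (iv) comes from testing the Cauchy criterion on the
    block n < k <= 2n at the point of modulus pi / (gamma^(alpha+1) n^alpha):
    there all the phases lie in a fixed closed subinterval of ]0, pi/2], so the
    sum of c_k over the block is small, and so is n c_n.

    The sufficiency halves, (ii) and (iv), rest on a bound for the partial sums
    S_k(x) of sin (f(k) x) that is uniform in x. By Abel summation the tail of
    the series is governed by the sum of |c_k - c_(k+1)| |S_k(x)|, and the class
    RBVS together with c_k k <= eps bounds the sum of |c_k - c_(k+1)| k over a
    dyadic block by a multiple of eps. It suffices that, for each x, the set of
    the scales k with |S_k(x)| >= k / D meets only O(log D) dyadic blocks:
    the levels D = 2^(i+1), weighted by 2^-i, then add up to a bounded multiple
    of eps ([oscillation_sum]).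

    The estimate on scales ([sin_sum_level_spread]) has two ingredients.
    - An inverse form of Weyl's inequality ([weyl_inverse]): if the exponential
      sum of length n of a polynomial phase of degree d is at least n / D, then
      the leading coefficient is within D^K / n^d of a rational whose
      denominator is at most D^K, where K depends on d only. The loss is a
      power of D and not a power of n, which is what makes summation over all
      scales possible.
    - Oddness of f: at a rational point a/q the values sin (2 pi f(k) a/q) are
      periodic in k and cancel over a full period, hence |S_n| <= q there.
    If |S_n(x)| >= n / D and |S_m(x)| >= m / D with n, m larger than a power
    of D, the two rational approximations of x have small denominators and are
    too close to be different. So there is a single rational a/q, and the
    distance beta from it satisfies |beta| m^d <= D^K by the first ingredient
    and |beta| n^d >= 1 / (C D) by the second, as S_n would otherwise be close
    to its value at a/q. Thus m / n is at most a power of D. *)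

(** * Elementary estimates for sine and cosine *)

Lemma sin_lip (R : realType) (x y : R) : `|sin x - sin y| <= `|x - y|.
Proof.
wlog xy : x y / x <= y.
  by move=> H; case: (leP x y) => [/H//|/ltW/H]; rewrite distrC (distrC y).
rewrite distrC.
have [z _ ->] : exists2 z, z \in `[x, y]%R & sin y - sin x = cos z * (y - x).
  apply: MVT_segment => //; apply: continuous_subspaceT.
  exact: continuous_sin.
by rewrite normrM (distrC x y) ler_piMl ?normr_ge0 ?cos_max.
Qed.

(** Writing sin x = 2 sin (x/2) cos (x/2), the mean value theorem at x/2 gives
    x cos (xi) cos (x/2), and both cosines are at least cos (pi/4). *)
Lemma sin_half_lower (R : realType) (x : R) :
  `|x| <= pi / 2 -> `|x| <= 2 * `|sin x|.
Proof.
wlog x0 : x / 0 <= x.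
  move=> H; case: (leP 0 x) => [/H//|/ltW x0].
  by rewrite -normrN -(normrN (sin x)) -sinN; apply: H; rewrite oppr_ge0.
rewrite (ger0_norm x0) => xp.
have pi0 : 0 < pi :> R := pi_gt0 R.
have c4 : cos (pi / 4) ^+ 2 = 2^-1 :> R.
  have := cos_mulr2n (pi / 4 : R).
  rewrite (_ : pi / 4 *+ 2 = pi / 2) ?cos_pihalf; last by field.
  by move=> /esym/eqP; rewrite subr_eq0 => /eqP h; lra.
have c0 : 0 <= cos (pi / 4 : R) by apply: cos_ge0_pihalf; lra.
have cmon (z : R) : 0 <= z <= pi / 4 -> cos (pi / 4) <= cos z.
  move=> /andP[z0 z1]; rewrite leNgt ltr_cos ?in_itv/= -?leNgt//; lra.
have [z] : exists2 z, z \in `[0, x / 2]%R & sin (x / 2) - sin 0 = cos z * (x / 2 - 0).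
  apply: MVT_segment => //; first lra.
  by apply: continuous_subspaceT; exact: continuous_sin.
rewrite in_itv/= => /andP[z0 zx]; rewrite sin0 !subr0 => e.
have s0 : 0 <= sin x by apply: sin_ge0_pi; lra.
rewrite (ger0_norm s0) (_ : sin x = sin (x / 2 *+ 2)); last by congr sin; field.
rewrite sin_mulr2n e.
have h1 : cos (pi / 4) <= cos z by apply: cmon; lra.
have h2 : cos (pi / 4) <= cos (x / 2) by apply: cmon; lra.
have h3 : cos (pi / 4) ^+ 2 <= cos (x / 2) * cos z by rewrite expr2 ler_pM.
rewrite c4 in h3.
have : x / 2 * 2^-1 <= x / 2 * (cos (x / 2) * cos z) by rewrite ler_wpM2l//; lra.
by lra.
Qed.

(** * Weyl differencing *)

(** A polynomial phase of degree d is described below by the fact that its d-th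
    forward difference is a constant th, that is, d! times the leading
    coefficient. This is stable under differencing with any step h, which
    turns th into h * th at order d - 1. *)
Definition fdiff (V : zmodType) (g : nat -> V) : nat -> V :=
  fun k => g k.+1 - g k.

(** Only the real part of the exponential sum is kept: a constant added to the
    phase g recovers any other component. *)
Definition cos_sum (R : realType) (n : nat) (g : nat -> R) : R :=
  \sum_(0 <= k < n) cos (2 * pi * g k).

Lemma cos_sum_le (R : realType) n (g : nat -> R) : `|cos_sum n g| <= n%:R.
Proof.
apply: le_trans (ler_norm_sum _ _ _) _.
apply: (@le_trans _ _ (\sum_(0 <= k < n) 1)).
  by apply: ler_sum => k _; exact: cos_max.
by rewrite sumr_const_nat subn0.
Qed.

(** The right-hand side without absolute values is exactly the squared modulus
    of the exponential sum, expanded along the differences h of the two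
    indices. *)
Lemma weyl_differencing (R : realType) n (g : nat -> R) :
  cos_sum n g ^+ 2 <=
  n%:R + 2 * \sum_(1 <= h < n) `|cos_sum (n - h) (fun k => g (k + h)%N - g k)|.
Proof.
pose s := \sum_(0 <= k < n) sin (2 * pi * g k).
have : cos_sum n g ^+ 2 + s ^+ 2 = n%:R + 2 * \sum_(1 <= h < n)
    cos_sum (n - h) (fun k => g (k + h)%N - g k).
  rewrite /s {s}; elim: n => [|n IH].
    by rewrite /cos_sum !big_geq// expr0n /= mulr0 !addr0.
  rewrite {1}/cos_sum !(@big_nat_recr _ _ _ n 0)//= -/(cos_sum n g).
  set s := \sum_(0 <= k < n) sin _ in IH *.
  set a := cos (2 * pi * g n); set b := sin (2 * pi * g n).
  have -> : \sum_(1 <= h < n.+1) cos_sum (n.+1 - h) (fun k => g (k + h)%N - g k) =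
     \sum_(1 <= h < n) cos_sum (n - h) (fun k => g (k + h)%N - g k) +
     (a * cos_sum n g + b * s).
    transitivity (\sum_(1 <= h < n.+1) (cos_sum (n - h) (fun k => g (k + h)%N - g k)
       + cos (2 * pi * (g n - g (n - h)%N)))).
      apply: eq_big_nat => h /andP[h0 hn].
      rewrite /cos_sum subSn// big_nat_recr//= subnK//.
    rewrite big_split /=; congr (_ + _).
      case: (n) => [|m]; first by rewrite !big_geq.
      by rewrite big_nat_recr//= subnn [cos_sum 0 _]big_geq// addr0.
    rewrite big_add1 /= big_nat_rev /= add0n.
    transitivity (\sum_(0 <= i < n) (a * cos (2 * pi * g i) + b * sin (2 * pi * g i))).
      apply: eq_big_nat => i /andP[_ iLn].
      by rewrite subnSK// subKn 1?ltnW// mulrBr cosB.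
    by rewrite big_split/= -!mulr_sumr.
  have ab : a ^+ 2 + b ^+ 2 = 1 by exact: cos2Dsin2.
  rewrite -natr1 mulrDr addrA (addrAC _ 1) -IH -[X in _ = _ + X + _]ab.
  by ring.
move=> e; apply: (@le_trans _ _ (cos_sum n g ^+ 2 + s ^+ 2)).
  by rewrite lerDl sqr_ge0.
rewrite e lerD2l ler_pM2l//; apply: ler_sum => h _; exact: ler_norm.
Qed.

Lemma round_int (R : realType) (x : R) : exists a : int, `|x - a%:~R| <= 1 / 2.
Proof.
exists (Num.floor (x + 1 / 2)).
have /andP[] := floor_itv (x + 1 / 2).
rewrite intrD => h1 h2; rewrite ler_norml; lra.
Qed.

Lemma fdiff_const_affine (R : realType) (g : nat -> R) th :
  (forall k, fdiff g k = th) -> forall k, g k = g 0%N + k%:R * th.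
Proof.
move=> H; elim=> [|k IH]; first by rewrite mul0r addr0.
have := H k; rewrite /fdiff IH => e.
by rewrite -[LHS](subrK (g 0%N + k%:R * th)) e -natr1; ring.
Qed.

Lemma cos_addint (R : realType) (x : R) (m : int) :
  cos (x + 2 * pi * m%:~R) = cos x.
Proof.
have nn (y : R) (n : nat) : cos (y + 2 * pi * n%:R) = cos y.
  rewrite (_ : 2 * pi * n%:R = pi *+ 2 *+ n); last by rewrite -mulr_natr -(mulr_natr pi 2); ring.
  by apply: periodicn; exact: cosD2pi.
case: (intP m) => [|n|n]; first by rewrite mulr0 addr0.
- exact: nn.
- rewrite mulrNz mulrN -[RHS](nn _ n.+1) -[in LHS](nn _ n.+1).
  by rewrite subrK nn.
Qed.

Lemma sin_addint (R : realType) (x : R) (m : int) :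
  sin (x + 2 * pi * m%:~R) = sin x.
Proof. by rewrite -!cosBpihalf addrAC cos_addint. Qed.

(** Multiplication by sin (pi th) makes the sum of a linear phase telescope. *)
Lemma cos_sum_affine (R : realType) (g : nat -> R) th n :
  (forall k, fdiff g k = th) -> `|sin (pi * th)| * `|cos_sum n g| <= 1.
Proof.
move=> /fdiff_const_affine H; rewrite -normrM /cos_sum mulr_sumr.
pose u k : R := sin (2 * pi * (g 0%N + k%:R * th) - pi * th) / 2.
rewrite (@telescope_sumr_eq _ 0%N n u)//.
  apply: le_trans (ler_normB _ _) _.
  have := sin_max (2 * pi * (g 0%N + n%:R * th) - pi * th).
  have := sin_max (2 * pi * (g 0%N + 0%:R * th) - pi * th).
  by rewrite !normrM !(@ger0_norm _ 2^-1)//; lra.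
move=> k _; rewrite H /u -[k.+1%:R]natr1.
set y := 2 * pi * (g 0%N + k%:R * th).
have -> : 2 * pi * (g 0%N + (k%:R + 1) * th) - pi * th = y + pi * th.
  by rewrite /y; ring.
by rewrite sinD sinB; field.
Qed.

(** * Integers whose multiples of a real are almost integral *)

Lemma int_small_eq0 (R : realType) (z : int) : `|z%:~R : R| <= 1 / 2 -> z = 0.
Proof.
move=> h; apply/eqP; rewrite -absz_eq0 -leqn0 -ltnS.
by rewrite -(ltr_nat R) natr_absz intr_norm; lra.
Qed.

(** If h phi is within eps of an integer a_h for all h in a short window, then
    the slopes (a_h - a_h') / (h - h') are all equal to one fraction b / r: two
    of them differing would have an integral cross product of size less than 1.
    All the differences are multiples of the reduced denominator r, so the
    number of elements bounds r from above, and the largest difference bounds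
    |r phi - b| with a gain proportional to the number of elements. *)
Lemma common_fraction (R : realType) (phi eps : R) (n W : nat)
    (G : {set 'I_n}) (a : 'I_n -> int) :
  (1 < #|G|)%N -> (0 < W)%N ->
  (forall h, h \in G -> `|h%:R * phi - (a h)%:~R| <= eps) ->
  (forall h h', h \in G -> h' \in G -> ((h' - h) * W < n)%N) ->
  8 * eps * n%:R <= W%:R ->
  exists (r : nat) (b : int), [/\ (0 < r)%N, (r * #|G|.-1 * W < n)%N &
    #|G|.-1%:R * `|r%:R * phi - b%:~R| <= 2 * eps].
Proof.
move=> G2 W0 Ga Gclose epsW.
have [h2 h2G] : exists h, h \in G by apply/card_gt0P; lia.
have [h0 h0G h0min] : exists2 h0, h0 \in G & forall h, h \in G -> (h0 <= h)%N.
  by case: (arg_minnP (fun h : 'I_n => nat_of_ord h) h2G) => h ? ?; exists h.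
have [h1 h1G h1max] : exists2 h1, h1 \in G & forall h, h \in G -> (h <= h1)%N.
  by case: (arg_maxnP (fun h : 'I_n => nat_of_ord h) h2G) => h ? H; exists h.
have h01 : (h0 < h1)%N.
  rewrite ltnNge; apply/negP => le10.
  move: G2; apply/negP; rewrite -leqNgt; apply/card_le1P => x xG y.
  rewrite inE; apply/idP/eqP => [yG|->//]; apply: val_inj => /=.
  have := (h0min _ xG, h0min _ yG, h1max _ xG, h1max _ yG).
  by move=> [[[? ?] ?] ?]; lia.
pose u (h : 'I_n) := (h - h0)%N; pose b h := a h - a h0.
have ub h : h \in G -> `|(u h)%:R * phi - (b h)%:~R| <= 2 * eps.
  move=> hG; rewrite /u /b natrB ?h0min// intrB.
  rewrite (_ : _ - _ = (h%:R * phi - (a h)%:~R) - (h0%:R * phi - (a h0)%:~R)); last by ring.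
  by apply: le_trans (ler_normB _ _) _; have := Ga _ hG; have := Ga _ h0G; lra.
have eps0 : 0 <= eps by apply: le_trans (Ga _ h0G).
have cross h : h \in G -> (u h)%:Z * b h1 = (u h1)%:Z * b h.
  move=> hG; apply/eqP; rewrite -subr_eq0; apply/eqP; apply: (@int_small_eq0 R).
  have W0' : 0 < W%:R :> R by rewrite ltr0n.
  rewrite -(ler_pM2l W0') intrB !intrM.
  have -> : (u h)%:~R * (b h1)%:~R - (u h1)%:~R * (b h)%:~R =
     (u h1)%:R * ((u h)%:R * phi - (b h)%:~R) -
     (u h)%:R * ((u h1)%:R * phi - (b h1)%:~R) :> R by ring.
  have e1 : (W%:R : R) * (u h)%:R <= n%:R.
    by rewrite -natrM ler_nat mulnC ltnW// Gclose.
  have e2 : (W%:R : R) * (u h1)%:R <= n%:R.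
    by rewrite -natrM ler_nat mulnC ltnW// Gclose.
  apply: (@le_trans _ _ (n%:R * (2 * eps) + n%:R * (2 * eps))); last by lra.
  rewrite -[X in X * `|_|]ger0_norm ?ler0n// -normrM mulrBr.
  apply: le_trans (ler_normB _ _) _; rewrite 2!(mulrA W%:R).
  by apply: lerD; rewrite normrM ler_pM ?ub// ger0_norm ?mulr_ge0.
(* The largest difference u h1 gives the reduced fraction b h1 / u h1. *)
pose g := gcdn (u h1) `|b h1|; pose r := (u h1 %/ g)%N.
have u0 : (0 < u h1)%N by rewrite /u subn_gt0.
have g0 : (0 < g)%N by rewrite gcdn_gt0 u0.
have rg : (r * g = u h1)%N by rewrite divnK ?dvdn_gcdl.
have r0 : (0 < r)%N by rewrite lt0n; apply/eqP => r0; move: u0; rewrite -rg r0.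
have rcop : coprime r (`|b h1| %/ g).
  rewrite /coprime -(eqn_pmul2r g0) mul1n muln_gcdl.
  by rewrite !divnK ?dvdn_gcdl ?dvdn_gcdr.
have rdvd h : h \in G -> (r %| u h)%N.
  move=> hG; rewrite -(Gauss_dvdl _ rcop) -(dvdn_pmul2r g0) rg -mulnA.
  rewrite divnK ?dvdn_gcdr//.
  have := congr1 absz (cross h hG); rewrite !abszM !absz_nat => ->.
  exact: dvdn_mulr.
(* The quotients u h / r are distinct integers in [0, g]. *)
have Gg : (#|G|.-1 <= g)%N.
  rewrite -subn1 leq_subLR add1n -[X in (_ <= X)%N](card_ord g.+1).
  pose f (h : 'I_n) : 'I_g.+1 := inord (u h %/ r).
  rewrite -(@card_in_imset _ _ f).
    exact: max_card.
  move=> h h' hG h'G /(congr1 val) /=.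
  have small x : x \in G -> (u x %/ r < g.+1)%N.
    move=> xG; rewrite ltnS -(leq_pmul2r r0) divnK ?rdvd// mulnC rg.
    by rewrite /u leq_sub2r// h1max.
  rewrite !inordK ?small// => /(congr1 (fun z => z * r)%N).
  rewrite !divnK ?rdvd// /u => e; apply: val_inj => /=.
  by have := h0min _ hG; have := h0min _ h'G; lia.
exists r, (b h1 %/ g%:Z)%Z; split => //.
  apply: leq_ltn_trans (Gclose _ _ h0G h1G); rewrite -/(u h1) -rg.
  by rewrite leq_mul2r leq_mul2l Gg !orbT.
apply: le_trans (ub _ h1G).
apply: (@le_trans _ _ (g%:R * `|r%:R * phi - (b h1 %/ g%:Z)%Z%:~R|)).
  by rewrite ler_wpM2r// ler_nat.
rewrite -{1}(@ger0_norm _ g%:R)// -normrM mulrBr mulrA -natrM mulnC rg.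
rewrite -[X in _ <= `|_ - X%:~R|](@divzK g%:Z) ?intrM.
  by rewrite [_ * g%:~R]mulrC.
exact: dvdn_gcdr.
Qed.

Lemma large_fiber (I J : finType) (H : {set I}) (f : I -> J) (N : nat) :
  (#|J| * N < #|H|)%N -> exists y, (N < #|[set h in H | f h == y]|)%N.
Proof.
move=> JN; apply/existsP; apply: contraLR JN; rewrite negb_exists -leqNgt.
move=> /forallP all_small; rewrite -sum1_card (partition_big f predT)//=.
rewrite -sum_nat_const; apply: leq_sum => y _.
have := all_small y; rewrite -leqNgt; apply: leq_trans.
by rewrite -sum1_card; apply: eq_leq; apply: eq_bigl => h; rewrite !inE.
Qed.

(** * An inverse form of the inequality of Weyl *)

Lemma iter_fdiff_shift (V : zmodType) (g : nat -> V) d h k :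
  iter d (@fdiff V) (fun k => g (k + h)%N - g k) k =
  iter d (@fdiff V) g (k + h)%N - iter d (@fdiff V) g k.
Proof.
elim: d k => [//|d IH] k; rewrite !iterS /fdiff !IH /fdiff addSn.
by rewrite !opprB addrACA [in RHS]addrACA; congr (_ + _); rewrite addrC.
Qed.

(** If the sum of length n is at least n / D, a proportion of at least D^-5 of
    the shifts h has a differenced sum that is at least n / D^5. The exponent 5
    only serves to absorb the constant: 8 D^2 <= D^5 as D >= 2. *)
Lemma many_large_shifts (R : realType) (D n : nat) (g : nat -> R) :
  (1 < D)%N -> (2 * D ^ 2 < n)%N -> n%:R <= D%:R * `|cos_sum n g| ->
  (n <= D ^ 5 * #|[set h : 'I_n | (0 < h)%N &
     (n%:R <= (D ^ 5)%:R * `|cos_sum (n - h) (fun k => g (k + h)%N - g k)|)%R]|)%N.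
Proof.
move=> D1 Dn big; set H := [set h | _].
have n0 : 0 < n%:R :> R by rewrite ltr0n; lia.
have D50 : 0 < (D ^ 5)%:R :> R by rewrite ltr0n expn_gt0; lia.
have D5 : 8 * (D ^ 2)%:R <= (D ^ 5)%:R :> R.
  rewrite -natrM ler_nat (expnD D 3 2) leq_mul2r.
  by rewrite (_ : 8 = 2 ^ 3)%N// leq_exp2r// D1 orbT.
have sumle : \sum_(1 <= h < n) `|cos_sum (n - h) (fun k => g (k + h)%N - g k)| <=
    n%:R * #|H|%:R + n%:R * (n%:R / (D ^ 5)%:R).
  rewrite big_geq_mkord /= (bigID (fun h => h \in H)) /=; apply: lerD.
    apply: (@le_trans _ _ (\sum_(i < n | i \in H) n%:R)); last first.
      by rewrite sumr_const -[leLHS]mulr_natr.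
    rewrite [leRHS](eq_bigl (fun i : 'I_n => (0 < i)%N && (i \in H))); last first.
      by move=> i; rewrite inE; case: (0 < i)%N.
    by apply: ler_sum => i _; apply: le_trans (cos_sum_le _ _) _; rewrite ler_nat leq_subr.
  apply: (@le_trans _ _ (\sum_(i < n) n%:R / (D ^ 5)%:R)); last first.
    by rewrite sumr_const card_ord -[leLHS]mulr_natl.
  rewrite big_mkcond /=; apply: ler_sum => i _; case: ifPn => [/andP[i0]|_].
    by rewrite inE i0 -ltNge => /ltW; rewrite ler_pdivlMr// mulrC.
  by rewrite divr_ge0// ltW.
have := weyl_differencing n g.
set S := \sum_(_ <= _ < _) _ in sumle *; set C := cos_sum n g in big *; move=> vdc.
have sq : n%:R ^+ 2 <= (D ^ 2)%:R * C ^+ 2.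
  rewrite natrX -(@real_normK _ C) ?num_real// -exprMn.
  by rewrite lerXn2r ?nnegrE ?mulr_ge0.
set h := (D ^ 2)%:R in D5 sq; set E := (D ^ 5)%:R in D50 D5 sumle *.
have h2n : 2 * h < n%:R by rewrite -natrM ltr_nat.
have h0 : 0 < h by rewrite ltr0n expn_gt0 (ltn_trans _ D1).
rewrite -(ler_nat R) natrM -/E.
have hE : h / E <= 1 / 8 by rewrite ler_pdivrMr//; lra.
have : n%:R * n%:R <= n%:R * (h + 2 * h * #|H|%:R + 2 * (h / E) * n%:R).
  rewrite -expr2; apply: le_trans sq _.
  apply: (@le_trans _ _ (h * (n%:R + 2 * (n%:R * #|H|%:R + n%:R * (n%:R / E))))).
    by rewrite ler_pM2l//; lra.
  by rewrite le_eqVlt; apply/orP; left; apply/eqP; ring.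
rewrite ler_pM2l// => key.
have : 2 * (h / E) * n%:R <= 1 / 4 * n%:R by rewrite ler_pM2r//; lra.
have : 8 * h * #|H|%:R <= E * #|H|%:R by rewrite ler_wpM2r.
by lra.
Qed.

(** The integer D >= 2 is the inverse of the relative size of the sum; since
    D >= 2, all numerical constants are absorbed into the exponent K. *)
Definition weyl_inverse_at (R : realType) (d K : nat) : Prop :=
  forall (D n : nat) (g : nat -> R) (th : R), (1 < D)%N ->
    (forall k, iter d (@fdiff R) g k = th) ->
    n%:R <= D%:R * `|cos_sum n g| ->
    exists (q : nat) (a : int), [/\ (0 < q)%N, (q <= D ^ K)%N &
      `|q%:R * th - a%:~R| * n%:R ^+ d <= (D ^ K)%:R].

(** A linear phase has bounded sums unless its slope is nearly integral. *)
Lemma weyl_inverse_linear (R : realType) : weyl_inverse_at R 1 1.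
Proof.
move=> D n g th D1 gth big.
have [a ha] := round_int th.
exists 1%N, a; split => //; first by rewrite expn1 ltnW.
rewrite mul1r expr1 expn1.
have pi2 : 2 <= pi :> R := pi_ge2 R.
have := cos_sum_affine n gth.
have -> : `|sin (pi * th)| = `|sin (pi * (th - a%:~R))|.
  have cs : cos (pi * a%:~R) ^+ 2 = 1 :> R.
    have := cos_mulr2n (pi * a%:~R : R).
    have -> : pi * a%:~R *+ 2 = 0 + 2 * pi * a%:~R :> R by ring.
    by rewrite cos_addint cos0 => ?; lra.
  have ss : sin (pi * a%:~R) = 0 :> R.
    by apply/eqP; rewrite -sqrf_eq0 sin2cos2 cs subrr.
  rewrite mulrBr sinB ss mulr0 subr0 normrM.
  suff -> : `|cos (pi * a%:~R)| = 1 :> R by rewrite mulr1.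
  by apply/eqP; rewrite -sqrp_eq1// real_normK ?num_real// cs.
set x := th - a%:~R in ha *; move=> H.
have : `|pi * x| <= 2 * `|sin (pi * x)|.
  apply: sin_half_lower; rewrite normrM ger0_norm ?pi_ge0//.
  by rewrite mulrC; have := ler_wpM2r (pi_ge0 R) ha; lra.
rewrite normrM (ger0_norm (pi_ge0 R)) => Hs.
have xs : `|x| <= `|sin (pi * x)|.
  have := ler_wpM2r (normr_ge0 x) pi2; lra.
apply: (@le_trans _ _ (`|x| * (D%:R * `|cos_sum n g|))).
  by rewrite ler_wpM2l.
rewrite mulrCA; apply: ler_piMr => //; apply: le_trans H.
by rewrite ler_wpM2r.
Qed.

(** Differencing produces many shifts h for which the induction hypothesis
    gives q_h such that q_h h th is almost an integer. The pigeonhole principle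
    selects many h with the same q_h in a window of length n / W, and the
    multiples h of phi = q_h th then satisfy [common_fraction], which gains
    the missing factor n. Here M bounds q_h, M' / n^(d+1) bounds the distance to
    the integers, and W = 8 M' is chosen to make the window short enough. *)
Lemma weyl_inverse_step (R : realType) (d K : nat) :
  weyl_inverse_at R d.+1 K ->
  weyl_inverse_at R d.+2 ((11 + 15 * K + 10 * d.+1) * d.+2).
Proof.
move=> IH.
set e := (11 + 15 * K + 10 * d.+1)%N => D n g th D1 gth big.
pose D5 := (D ^ 5)%N; pose M := (D5 ^ K)%N; pose M' := (M * D5 ^ d.+1)%N.
pose W := (8 * M')%N; pose P := (D5 * M.+1 * W)%N.
have D0 : (0 < D)%N by lia.
have M0 : (0 < M)%N by rewrite !expn_gt0 D0.
have M'0 : (0 < M')%N by rewrite muln_gt0 M0 !expn_gt0 D0.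
have D50 : (0 < D5)%N by rewrite expn_gt0 D0.
have W0 : (0 < W)%N by rewrite muln_gt0 M'0.
have P0 : (0 < P)%N by rewrite /P muln_gt0 W0 muln_gt0 D50.
have Xle : (4 * P * M' <= D ^ e)%N.
  have -> : (D ^ e = D ^ 2 * (D ^ 5 * (D ^ 1 * M) * (D ^ 3 * M')) * M')%N.
    rewrite /M' /M /D5 -!expnM -!expnD; congr (D ^ _)%N; rewrite /e; lia.
  rewrite leq_mul2r !leq_mul ?orbT//.
  - by rewrite (_ : 4 = 2 ^ 2)%N// leq_exp2r.
  - by rewrite expn1 -addn1; nia.
  - by rewrite (_ : 8 = 2 ^ 3)%N// leq_exp2r.
have Dee : (D ^ e <= D ^ (e * d.+2))%N by rewrite leq_pexp2l//; lia.
(* For n at most a power of D the nearest integer to th is good enough. *)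
have [nP|Pn] := leqP n P.
  have [a ha] := round_int th.
  exists 1%N, a; split => //; first by rewrite expn_gt0 D0.
  rewrite mul1r expnM natrX.
  apply: (@le_trans _ _ (1 * n%:R ^+ d.+2)).
    by rewrite ler_wpM2r// ?exprn_ge0//; lra.
  rewrite mul1r lerXn2r ?nnegrE// ler_nat.
  by apply: leq_trans Xle; nia.
have n0 : (0 < n)%N by lia.
have n0R : 0 < n%:R :> R by rewrite ltr0n.
have Dn : (2 * D ^ 2 < n)%N.
  apply: leq_ltn_trans Pn; rewrite /P /W.
  have : (D ^ 2 <= D5)%N by rewrite leq_pexp2l.
  by nia.
have := many_large_shifts D1 Dn big; set H := [set h | _] => Hcard.
have HA : forall h : 'I_n, exists qa : nat * int, h \in H ->
    [/\ (0 < qa.1)%N, (qa.1 <= M)%N &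
      `|h%:R * (qa.1%:R * th) - qa.2%:~R| <= M'%:R / n%:R ^+ d.+1].
  move=> h; have [|/negP hH] := boolP (h \in H); last by exists (0%N, 0).
  rewrite inE => /andP[h0 hbig].
  have D51 : (1 < D5)%N by rewrite -(exp1n 5) ltn_exp2r.
  have nh : n%:R <= D5%:R * (n - h)%:R :> R.
    by apply: le_trans hbig _; rewrite ler_wpM2l// cos_sum_le.
  have [||q [a [q0 qM qa]]] := IH D5 (n - h)%N (fun k => g (k + h)%N - g k) (h%:R * th) D51.
  - move=> k; rewrite iter_fdiff_shift.
    have aff := fdiff_const_affine (g := iter d.+1 (@fdiff R) g) gth.
    by rewrite (aff (k + h)%N) (aff k) natrD; ring.
  - by apply: le_trans hbig; rewrite ler_nat leq_subr.
  exists (q, a) => _; split => //=.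
  rewrite ler_pdivlMr ?exprn_gt0// mulrCA.
  apply: (@le_trans _ _ (`|q%:R * (h%:R * th) - a%:~R| * (D5%:R ^+ d.+1 * (n - h)%:R ^+ d.+1))).
    by rewrite ler_wpM2l// -exprMn lerXn2r ?nnegrE ?mulr_ge0.
  by rewrite mulrCA [leRHS]natrM mulrC natrX ler_wpM2r ?exprn_ge0.
have [qa HqaA] := choice HA.
have blk (h : 'I_n) : (h * W %/ n < W)%N.
  by rewrite ltn_divLR// mulnC ltn_pmul2l.
(* The pigeonholes: the denominator q_h and the window containing h. *)
pose f (h : 'I_n) : 'I_M.+1 * 'I_W := (inord (qa h).1, Ordinal (blk h)).
(* The selected class has more than N elements, and N is comparable to n / P. *)
pose N := (n.-1 %/ P)%N.
have NP : (N * P < n)%N by have := leq_trunc_div n.-1 P; rewrite -/N; lia.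
have nN : (n <= P * N.+1)%N by rewrite mulnC; have := ltn_ceil n.-1 P0; lia.
have N0 : (0 < N)%N by rewrite divn_gt0//; lia.
have NP2 : (P * N.+1 <= 2 * P * N)%N.
  rewrite (mulnC 2) -mulnA leq_mul2l mul2n -addnn -addn1 leq_add2l N0.
  by rewrite orbT.
have [y] : exists y, (N < #|[set h in H | f h == y]|)%N.
  apply: large_fiber; rewrite card_prod !card_ord -(ltn_pmul2l D50).
  by apply: leq_trans Hcard; move: NP; rewrite /P; lia.
set G := [set h in H | _] => GN.
have NG : (N <= #|G|.-1)%N by rewrite -ltnS (ltn_predK GN).
have GH h : h \in G -> [/\ h \in H, (qa h).1 = y.1 & (h * W %/ n = y.2)%N].
  rewrite inE => /andP[hH /eqP <-]; split => //=.
  by rewrite inordK// ltnS; have [] := HqaA _ hH.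
pose eps : R := M'%:R / n%:R ^+ d.+1.
have [||||r [b [r0 rsmall rb]]] := @common_fraction R (y.1%:R * th) eps n W G
    (fun h => (qa h).2) _ W0.
- by apply: leq_trans GN.
- by move=> h /GH[hH <- _]; have [] := HqaA _ hH.
- move=> h h' /GH[_ _ e1] /GH[_ _ e2].
  rewrite mulnBl (divn_eq (h * W) n) (divn_eq (h' * W) n) e1 e2 subnDl.
  by apply: leq_ltn_trans (leq_subr _ _) _; rewrite ltn_pmod.
- rewrite /eps /W natrM -mulrA ler_pM2l// -mulrA ler_piMr//.
  by rewrite exprS invfM mulrAC mulVf ?mul1r ?gt_eqF// invf_le1 ?exprn_gt0// exprn_ege1// ler1n.
have y0 : (0 < y.1)%N.
  have [h /GH[hH <- _]] : exists h, h \in G by apply/card_gt0P; lia.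
  by have [] := HqaA _ hH.
exists (r * y.1)%N, b; split; first by rewrite muln_gt0 r0.
  apply: leq_trans Dee; apply: leq_trans Xle.
  have yM : (y.1 <= M')%N.
    apply: (@leq_trans M); first by rewrite -ltnS.
    by rewrite /M' leq_pmulr// expn_gt0 D50.
  apply: leq_mul => //; apply: (@leq_trans (r * W)); first by rewrite leq_pmulr.
  apply: (@leq_trans (2 * P)); last by rewrite leq_mul2r orbT.
  rewrite -(leq_pmul2r N0) mulnAC; apply: leq_trans NP2; apply: leq_trans nN.
  by apply: ltnW; apply: leq_ltn_trans rsmall; rewrite !leq_mul.
apply: (@le_trans _ _ (4 * P * M')%:R); last first.
  by rewrite ler_nat (leq_trans Xle).
rewrite [(r * _)%:R]natrM -mulrA exprS mulrA -ler_pdivlMr ?exprn_gt0//.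
rewrite [(_ * M')%:R]natrM -mulrA -/eps.
apply: (@le_trans _ _ (`|r%:R * (y.1%:R * th) - b%:~R| * ((2 * P)%:R * #|G|.-1%:R))).
  rewrite ler_wpM2l// -natrM ler_nat; apply: leq_trans nN _.
  by apply: leq_trans NP2 _; rewrite leq_mul.
rewrite mulrCA (_ : 4 * P = 2 * P * 2)%N; last by lia.
by rewrite [X in _ <= X * _]natrM -mulrA ler_wpM2l// mulrC.
Qed.

Lemma weyl_inverse (R : realType) d : (0 < d)%N -> exists K, weyl_inverse_at R d K.
Proof.
case: d => [//|d _]; elim: d => [|d [K IH]].
  by exists 1%N; exact: weyl_inverse_linear.
by exists ((11 + 15 * K + 10 * d.+1) * d.+2)%N; exact: weyl_inverse_step.
Qed.

(** * Sine sums of odd integer polynomials *)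

Lemma iter_fdiff_poly (A : comNzRingType) d (p : {poly A}) (k : nat) :
  (size p <= d.+1)%N ->
  iter d (@fdiff A) (fun k => p.[k%:R]) k = d`!%:R * p`_d.
Proof.
elim: d p k => [|d IH] p k sp.
  by rewrite /= (size1_polyC sp) hornerC coefC eqxx fact0 mul1r.
(* only the top monomial contributes in degree d.+1 *)
pose r := \poly_(i < d.+1) p`_i.
pose m : {poly A} := \poly_(i < d.+1) 'C(d.+1, i)%:R.
have rE j : iter d (@fdiff A) (fun k => r.[k%:R]) j = d`!%:R * r`_d.
  by apply: IH; exact: size_poly.
have mE j : iter d (@fdiff A) (fun k => m.[k%:R]) j = d`!%:R * m`_d.
  by apply: IH; exact: size_poly.
have pE (x : A) : p.[x] = p`_d.+1 * x ^+ d.+1 + r.[x].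
  by rewrite (horner_coef_wide _ sp) big_ord_recr /= addrC horner_poly.
have mono (x : A) : (x + 1) ^+ d.+1 - x ^+ d.+1 = m.[x].
  rewrite (addrC x 1) exprDn big_ord_recr /= subnn expr0 mul1r.
  rewrite horner_poly binn mulr1n addrK; apply: eq_bigr => i _.
  by rewrite expr1n mul1r mulr_natl.
have split e j : iter e (@fdiff A) (fdiff (fun k => p.[k%:R])) j =
    p`_d.+1 * iter e (@fdiff A) (fun k => m.[k%:R]) j +
    (iter e (@fdiff A) (fun k => r.[k%:R]) j.+1 -
     iter e (@fdiff A) (fun k => r.[k%:R]) j).
  elim: e j => [|e IHe] j; last by rewrite !iterS /fdiff !IHe; ring.
  by rewrite /= /fdiff !pE -mono -natr1; ring.
rewrite iterSr split mE !rE subrr addr0 coef_poly ltnSn -bin_sub// subSnn bin1.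
by rewrite factS natrM; ring.
Qed.

Lemma iter_fdiff_succ (V : zmodType) (g : nat -> V) (c : V) d k :
  iter d.+1 (@fdiff V) (fun k => g k.+1 - c) k = iter d.+1 (@fdiff V) g k.+1.
Proof.
elim: d k => [|d IH] k; first by rewrite /= /fdiff opprB addrA subrK.
by rewrite iterS {1}/fdiff !IH.
Qed.

(** The variable t is x / (2 pi), so that the rational t are the centres of the
    major arcs. *)
Definition poly_sin (R : realType) (F : {poly int}) (t : R) (k : nat) : R :=
  sin (2 * pi * (F.[k%:R]%:~R * t)).

Definition sin_sum (R : realType) (F : {poly int}) (n : nat) (t : R) : R :=
  \sum_(1 <= k < n.+1) poly_sin F t k.

(** The integer d! F_d multiplying t is absorbed into the denominator, which
    accounts for the factor b. *)
Lemma weyl_inverse_sin (R : realType) (F : {poly int}) d :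
  (0 < d)%N -> size F = d.+1 ->
  exists b K : nat, (0 < b)%N /\
    forall (D n : nat) (t : R), (1 < D)%N -> n%:R <= D%:R * `|sin_sum F n t| ->
    exists (q : nat) (a : int), [/\ (0 < q)%N, (q <= b * D ^ K)%N &
      `|q%:R * t - a%:~R| * n%:R ^+ d <= (D ^ K)%:R].
Proof.
move=> d0 sF; have [K HK] := weyl_inverse R d0.
pose B : int := d`!%:R * F`_d.
have B0 : B != 0.
  rewrite mulf_neq0 ?pnatr_eq0 -?lt0n ?fact_gt0//.
  by rewrite -[d]/(d.+1.-1) -sF -lead_coefE lead_coef_eq0 -size_poly_gt0 sF.
exists `|B|%N, K; split; first by rewrite absz_gt0.
move=> D n t D1 big.
pose g (k : nat) : R := F.[k.+1%:R]%:~R * t - 1 / 4.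
have gE k : iter d (@fdiff R) g k = B%:~R * t.
  pose p : {poly R} := t *: map_poly intr F.
  have -> : g = fun k => p.[k.+1%:R] - 1 / 4.
    apply/funext => j; rewrite /g hornerZ mulrC.
    by rewrite -[j.+1%:R in RHS]/((Posz j.+1)%:~R) horner_map /= natz.
  rewrite -(prednK d0) (iter_fdiff_succ (fun k => p.[k%:R])) (prednK d0).
  rewrite iter_fdiff_poly; last first.
    by rewrite (leq_trans (size_scale_leq _ _))// (leq_trans (size_poly _ _))// sF.
  by rewrite coefZ coef_map /= /B intrM natz; ring.
(* Shifting the phase by a quarter turn changes the sine into a cosine. *)
have SE : sin_sum F n t = cos_sum n g.
  rewrite /sin_sum big_add1 /=; apply: eq_big_nat => k _; rewrite /poly_sin -cosBpihalf.
  by congr cos; rewrite /g; field.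
rewrite SE in big.
have [q [a [q0 qD qa]]] := HK D n g _ D1 gE big.
exists (q * `|B|)%N, (sgz B * a); split.
- by rewrite muln_gt0 q0 absz_gt0.
- by rewrite mulnC leq_mul2l qD orbT.
suff -> : `|(q * `|B|)%:R * t - (sgz B * a)%:~R| = `|q%:R * (B%:~R * t) - a%:~R| by [].
have sB : `|(sgz B)%:~R : R| = 1 by rewrite -intr_norm; case: sgzP B0.
transitivity (`|(sgz B)%:~R : R| * `|q%:R * (B%:~R * t) - a%:~R|); last first.
  by rewrite sB mul1r.
rewrite -normrM natrM -[X in _ * X * t]/((Posz `|B|)%:~R) abszEsg !intrM.
by congr `|_|; ring.
Qed.

Lemma horner_addM (F : {poly int}) (x y : int) :
  exists z, F.[x + y] = F.[x] + y * z.
Proof.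
elim/poly_ind: F => [|p c [z IH]]; first by exists 0; rewrite !horner0 mulr0 addr0.
exists (p.[x] + z * (x + y)); rewrite !hornerMXaddC IH; ring.
Qed.

Lemma horner_odd (F : {poly int}) (x : int) :
  (forall j, ~~ odd j -> F`_j = 0) -> F.[- x] = - F.[x].
Proof.
move=> Fodd; rewrite !horner_coef -sumrN; apply: eq_bigr => i _.
have [oi|/Fodd->] := boolP (odd i); last by rewrite !mul0r oppr0.
by rewrite exprNn -signr_odd oi expr1 mulN1r mulrN.
Qed.

Definition poly_height (F : {poly int}) : nat := (\sum_(i < size F) `|(F`_i)%R|)%N.

Lemma horner_le_height (R : realType) (F : {poly int}) d (k n : nat) :
  size F = d.+1 -> (0 < n)%N -> (k <= n)%N ->
  `|F.[k%:R]%:~R| <= (poly_height F)%:R * n%:R ^+ d :> R.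
Proof.
move=> sF n0 kn; rewrite horner_coef rmorph_sum /=.
apply: le_trans (ler_norm_sum _ _ _) _.
rewrite /poly_height natr_sum mulr_suml; apply: ler_sum => i _.
rewrite intrM normrM natr_absz intr_norm ler_wpM2l// rmorphXn /= natz.
rewrite ger0_norm ?exprn_ge0//; apply: (@le_trans _ _ (n%:R ^+ i)).
  by rewrite lerXn2r ?nnegrE// ler_nat.
by rewrite ler_weXn2l ?ler1n// -ltnS -sF.
Qed.

(** For odd F the terms are periodic modulo q and antisymmetric under
    k -> q - k, so the sum over a full period vanishes. *)
Lemma sin_sum_rational (R : realType) (F : {poly int}) (q n : nat) (a : int) :
  (forall j, ~~ odd j -> F`_j = 0) -> (0 < q)%N ->
  `|sin_sum F n (a%:~R / q%:R : R)| <= q%:R.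
Proof.
move=> Fodd q0; set t := _ / _.
have q0R : q%:R != 0 :> R by rewrite pnatr_eq0 -lt0n.
pose s := poly_sin F t.
have shift (x : int) : sin (2 * pi * (F.[x + q%:Z]%:~R * t)) =
    sin (2 * pi * (F.[x]%:~R * t)).
  have [z ->] := horner_addM F x q%:Z.
  rewrite -[RHS](sin_addint _ (z * a)); congr sin.
  by rewrite intrD !intrM /t; field.
have per k : s (k + q)%N = s k by rewrite /s /poly_sin natrD !natz shift.
have refl k : (k <= q)%N -> s (q - k)%N = - s k.
  move=> kq; rewrite /s /poly_sin natrB// addrC !natz shift horner_odd//.
  by rewrite -sinN; congr sin; rewrite mulrNz; ring.
have s0 : s 0%N = 0.
  have := refl 0%N isT; rewrite subn0 -[q]add0n per => /eqP.
  by rewrite -addr_eq0 -mulr2n mulrn_eq0 => /eqP.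
have full : \sum_(0 <= k < q) s k = 0.
  have e : \sum_(0 <= k < q) s k = \sum_(1 <= k < q) s k.
    by rewrite big_ltn// s0 add0r.
  rewrite e; set T := \sum_(_ <= _ < _) _.
  have : T = - T.
    rewrite {1}/T big_nat_rev /= -sumrN; apply: eq_big_nat => k /andP[_ kq].
    by rewrite add1n subSS refl// ltnW.
  by move/eqP; rewrite -addr_eq0 -mulr2n mulrn_eq0 => /eqP.
have bound m : `|\sum_(0 <= k < m) s k| <= q%:R.
  have [r [mr rq]] : exists r, \sum_(0 <= k < m) s k = \sum_(0 <= k < r) s k /\ (r <= q)%N.
    elim/ltn_ind: m => m IH; have [mq|qm] := leqP m q; first by exists m.
    have [|r [e rq]] := IH (m - q)%N; [lia|].
    exists r; split => //; rewrite -e (@big_cat_nat _ _ _ q)//=; last exact: ltnW.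
    rewrite full add0r -{1}[q]add0n big_addn; apply: eq_bigr => k _; exact: per.
  rewrite mr; apply: le_trans (ler_norm_sum _ _ _) _.
  apply: (@le_trans _ _ (\sum_(0 <= k < r) 1)).
    by apply: ler_sum => k _; exact: sin_max.
  by rewrite sumr_const_nat subn0 ler_nat.
by have := bound n.+1; rewrite big_ltn// s0 add0r.
Qed.

(** Termwise comparison with the sum at the rational a/q. No approximation by
    an integral is involved: the error is acceptable as long as n^d times the
    distance to a/q is small. *)
Lemma sin_sum_near_rational (R : realType) (F : {poly int}) d (q n : nat) (a : int) (t : R) :
  size F = d.+1 -> (forall j, ~~ odd j -> F`_j = 0) -> (0 < q)%N -> (0 < n)%N ->
  `|sin_sum F n t| <= q%:R +
    n%:R * (8 * (poly_height F)%:R * (n%:R ^+ d * `|t - a%:~R / q%:R|)).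
Proof.
move=> sF Fodd q0 n0; set t0 := _ / _.
rewrite -(subrK (sin_sum F n t0) (sin_sum F n t)) addrC.
apply: le_trans (ler_normD _ _) _; apply: lerD; first exact: sin_sum_rational.
rewrite /sin_sum -sumrB; apply: le_trans (ler_norm_sum _ _ _) _.
set X := (X in _ * X).
apply: (@le_trans _ _ (\sum_(1 <= k < n.+1) X)); last first.
  by rewrite sumr_const_nat subn1 mulr_natl.
rewrite big_nat [leRHS]big_nat; apply: ler_sum => k /andP[_ kn].
apply: le_trans (sin_lip _ _) _.
rewrite -mulrBr -mulrBr !normrM (@ger0_norm _ 2)// (ger0_norm (pi_ge0 R)).
rewrite /X !mulrA ler_wpM2r// -!mulrA (mulrA 2 pi).
have := horner_le_height R sF n0 (kn : (k <= n)%N).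
have [/andP[_ p4] _] := pihalf_02_cos_pihalf R => h.
by rewrite ler_pM ?mulr_ge0 ?pi_ge0//; lra.
Qed.

(** For fixed t, the scales beyond D^K at which the sum is at least 1 / D of
    its length span a factor of at most D^K. *)
Lemma sin_sum_level_spread (R : realType) (F : {poly int}) d :
  (0 < d)%N -> size F = d.+1 -> (forall j, ~~ odd j -> F`_j = 0) ->
  exists K : nat, forall (D n m : nat) (t : R), (1 < D)%N ->
    (D ^ K <= n)%N -> (n <= m)%N ->
    n%:R <= D%:R * `|sin_sum F n t| -> m%:R <= D%:R * `|sin_sum F m t| ->
    (m <= D ^ K * n)%N.
Proof.
move=> d0 sF Fodd; have [b [K [b0 HK]]] := weyl_inverse_sin R d0 sF.
pose h := poly_height F; pose Z := (16 * b * h.+1)%N.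
exists (2 * K + 1 + Z)%N => D n m t D1 Dn nm bign bigm.
have D0 : (0 < D)%N by lia.
have bZ : (4 * b <= Z)%N.
  by rewrite -[leqLHS]muln1 leq_mul// leq_mul2r orbT.
have ZD : (Z <= D ^ Z)%N by rewrite ltnW// ltn_expl.
have DK : (D ^ K <= D ^ (2 * K))%N by rewrite leq_pexp2l//; lia.
have DK0 : (0 < D ^ K)%N by rewrite expn_gt0 D0.
have big : (D ^ (2 * K) * D * Z <= D ^ (2 * K + 1 + Z))%N.
  by rewrite 2!expnD expn1 leq_mul2l ZD orbT.
have n0 : (0 < n)%N by apply: leq_trans Dn; rewrite expn_gt0 D0.
have m0 : (0 < m)%N by apply: leq_trans nm.
have [q1 [a1 [q10 q1b qa1]]] := HK D n t D1 bign.
have [q2 [a2 [q20 q2b qa2]]] := HK D m t D1 bigm.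
have nd k : (0 < k)%N -> k%:R <= k%:R ^+ d :> R.
  by move=> k0; rewrite -{1}[k%:R]expr1 ler_weXn2l// ler1n.
have n0R : 0 < n%:R :> R by rewrite ltr0n.
have q10R : 0 < q1%:R :> R by rewrite ltr0n.
have q20R : 0 < q2%:R :> R by rewrite ltr0n.
have D0R : 0 < D%:R :> R by rewrite ltr0n.
(* the two rationals have small denominators and are very close *)
have same : q1%:Z * a2 = q2%:Z * a1.
  apply/eqP; rewrite -subr_eq0; apply/eqP; apply: (@int_small_eq0 R).
  rewrite -(ler_pM2r n0R) intrB !intrM.
  have -> : q1%:~R * a2%:~R - q2%:~R * a1%:~R =
    q2%:R * (q1%:R * t - a1%:~R) - q1%:R * (q2%:R * t - a2%:~R) :> R by ring.
  apply: (@le_trans _ _ ((b * D ^ K)%:R * (D ^ K)%:R + (b * D ^ K)%:R * (D ^ K)%:R)).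
    apply: (@le_trans _ _ ((q2%:R * `|q1%:R * t - a1%:~R| + q1%:R * `|q2%:R * t - a2%:~R|) * n%:R)).
      rewrite ler_wpM2r//; apply: le_trans (ler_normB _ _) _.
      by rewrite !normrM !normr_nat.
    rewrite mulrDl -!mulrA; apply: lerD; apply: ler_pM => //; rewrite ?mulr_ge0// ?ler_nat//.
      by apply: le_trans qa1; rewrite ler_wpM2l// nd.
    apply: le_trans qa2; rewrite ler_wpM2l//.
    by apply: (@le_trans _ _ m%:R); rewrite ?ler_nat// nd.
  rewrite -!natrM -natrD mul1r ler_pdivlMl// -natrM ler_nat.
  apply: leq_trans Dn; apply: leq_trans big.
  have -> : (D ^ (2 * K) = D ^ K * D ^ K)%N by rewrite mul2n -addnn expnD.
  have h4 : (4 * b <= D * Z)%N by rewrite (leq_trans bZ)// leq_pmull.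
  apply: (@leq_trans (D ^ K * D ^ K * (4 * b))%N).
    by apply: eq_leq; ring.
  by rewrite -[leqRHS]mulnA leq_mul2l h4 orbT.
have beta1 : a1%:~R / q1%:R = a2%:~R / q2%:R :> R.
  apply/eqP; rewrite eqr_div ?lt0r_neq0//; apply/eqP.
  have := congr1 (fun z => z%:~R : R) same; rewrite !intrM => e.
  by rewrite mulrC [RHS]mulrC; exact/esym/e.
set x := `|t - a1%:~R / q1%:R|.
have x0 : 0 <= x := normr_ge0 _.
have mx : m%:R ^+ d * x <= (D ^ K)%:R.
  apply: le_trans qa2; rewrite mulrC ler_wpM2r ?exprn_ge0//.
  rewrite /x beta1.
  have -> : q2%:R * t - a2%:~R = q2%:R * (t - a2%:~R / q2%:R) :> R.
    by field; rewrite lt0r_neq0.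
  by rewrite normrM normr_nat ler_peMl// ler1n.
(* Since q1 is small compared with n, the sum at n is too large to be
   explained by the periodic part alone. *)
have low : 1 <= 16 * h%:R * D%:R * (n%:R ^+ d * x).
  have near := sin_sum_near_rational a1 t sF Fodd q10 n0.
  have : n%:R <= D%:R * (q1%:R + n%:R * (8 * h%:R * (n%:R ^+ d * x))).
    by apply: le_trans bign _; rewrite ler_pM2l.
  have : 2 * (D%:R * q1%:R) <= n%:R :> R.
    rewrite -!natrM ler_nat; apply: leq_trans Dn; apply: leq_trans big.
    apply: (@leq_trans (D * (2 * (b * D ^ (2 * K))))%N).
      by rewrite mulnCA leq_mul2l leq_mul2l (leq_trans q1b) ?orbT// leq_mul2l DK orbT.
    have -> : (D * (2 * (b * D ^ (2 * K))) = D ^ (2 * K) * D * (2 * b))%N by ring.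
    by rewrite leq_mul2l (leq_trans _ bZ) ?orbT// leq_mul2r orbT.
  move=> e1 e2; rewrite -(ler_pM2l n0R); lra.
have mD : m%:R ^+ d <= (16 * h * D * D ^ K)%:R * n%:R ^+ d :> R.
  apply: (@le_trans _ _ (m%:R ^+ d * (16 * h%:R * D%:R * (n%:R ^+ d * x)))).
    by rewrite ler_peMr// exprn_ge0.
  have -> : m%:R ^+ d * (16 * h%:R * D%:R * (n%:R ^+ d * x)) =
    16 * h%:R * D%:R * n%:R ^+ d * (m%:R ^+ d * x) by ring.
  rewrite !natrM [leRHS]mulrAC ler_wpM2l ?mulr_ge0 ?exprn_ge0//.
have : (m <= 16 * h * D * D ^ K * n)%N.
  rewrite -(ler_nat R).
  have nd0 : 0 < n%:R ^+ d.-1 :> R by rewrite exprn_gt0.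
  rewrite -(ler_pM2r nd0) natrM -mulrA -exprS (prednK d0).
  apply: le_trans mD; rewrite -[X in _ <= _ ^+ X](prednK d0) exprS.
  by rewrite ler_wpM2l// lerXn2r ?nnegrE// ler_nat.
move/leq_trans; apply; rewrite leq_mul2r; apply/orP; right.
apply: leq_trans big; rewrite -mulnA mulnC (mulnC D) leq_mul//.
  by rewrite leq_mul2r DK orbT.
by rewrite leq_mul// leq_pmulr.
Qed.

Local Open Scope classical_set_scope.
Local Open Scope ring_scope.

(** * Convergence criteria *)

Lemma ucvg_cauchyP (R : realType) (c f : nat -> R) (E : set R) :
  sin_series_ucvg c f E <-> forall eps : R, 0 < eps -> exists N : nat,
    forall n m x, (N <= n)%N -> (n <= m)%N -> E x ->
      `|sin_psum c f m x - sin_psum c f n x| <= eps.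
Proof.
split=> [[g cg] eps e0|cau].
  have e20 : 0 < eps / 2 by lra.
  have /cg [N _ HN] : nbhs (g : {uniform` E -> R})
      [set h : R -> R | forall y, E y -> ball (g y) (eps / 2) (h y)].
    apply/uniform_nbhs; exists [set xy | ball xy.1 (eps / 2) xy.2]; split => //.
    exact: entourage_ball (PosNum e20).
  exists N => n m x Nn nm Ex.
  have h1 : `|g x - sin_psum c f n x| < eps / 2 := HN n Nn x Ex.
  have h2 : `|g x - sin_psum c f m x| < eps / 2 := HN m (leq_trans Nn nm) x Ex.
  rewrite (_ : _ - _ = (g x - sin_psum c f n x) - (g x - sin_psum c f m x)); last by ring.
  by apply: le_trans (ler_normB _ _) _; lra.
have pt x : E x -> cvgn (fun n => sin_psum c f n x).
  move=> Ex; apply/cauchy_cvgP; apply: cauchy_exP => e e0.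
  have e20 : 0 < e / 2 by lra.
  have [N HN] := cau _ e20.
  exists (sin_psum c f N x); exists N => // n /= Nn.
  rewrite /ball /= distrC; apply: le_lt_trans (HN N n x _ _ _) _ => //; lra.
exists (fun x => limn (fun n => sin_psum c f n x)).
move=> P /uniform_nbhs[U [+ UP]]; rewrite -entourage_ballE => -[e /= e0 eU].
have e20 : 0 < e / 2 by lra.
have [N HN] := cau _ e20.
exists N => // n /= Nn; apply: UP => x Ex; apply: eU => /=.
have cx := pt x Ex.
rewrite /ball /= (@le_lt_trans _ _ (e / 2))//; last lra.
rewrite ler_norml; apply/andP; split.
  rewrite lerBrDl; apply: limr_ge => //; exists n => // m /= nm.
  by have := HN n m x Nn nm Ex; rewrite ler_norml => /andP[]; lra.
rewrite lerBlDl; apply: limr_le => //; exists n => // m /= nm.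
by have := HN n m x Nn nm Ex; rewrite ler_norml => /andP[]; lra.
Qed.

Lemma summable_from1P (R : realType) (c : nat -> R) :
  (forall k, (1 <= k)%N -> 0 <= c k) ->
  summable_from1 c <-> exists M : R, forall n, \sum_(1 <= k < n) c k <= M.
Proof.
move=> c0; split=> [sc|[M HM]].
  have fin : (\sum_(1 <= k <oo) (c k)%:E)%E \is a fin_num.
    rewrite ge0_fin_numE//; apply: nneseries_ge0 => k k1 _.
    by rewrite lee_fin c0.
  exists (fine (\sum_(1 <= k <oo) (c k)%:E)%E) => n.
  rewrite -lee_fin fineK// -sumEFin; apply: nneseries_lim_ge => k k1 _.
  by rewrite lee_fin c0.
apply: (@le_lt_trans _ _ M%:E); last exact: ltry.
apply: lime_le.
  by apply: is_cvg_nneseries => k k1 _; rewrite lee_fin c0.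
by apply: nearW => n; rewrite sumEFin lee_fin.
Qed.

Lemma summable_tail (R : realType) (c : nat -> R) :
  (forall k, (1 <= k)%N -> 0 <= c k) -> summable_from1 c ->
  forall eps : R, 0 < eps -> exists N : nat, forall n m, (N <= n)%N ->
    (n <= m)%N -> \sum_(n.+1 <= k < m.+1) c k <= eps.
Proof.
move=> c0 /(summable_from1P c0)[M HM] eps e0.
pose A n := \sum_(1 <= k < n.+1) c k.
have Asplit n m : (n <= m)%N -> A m = A n + \sum_(n.+1 <= k < m.+1) c k.
  by move=> nm; rewrite /A (@big_cat_nat _ _ _ n.+1).
have And : nondecreasing_seq A.
  move=> n m nm; rewrite (Asplit _ _ nm) lerDl big_nat; apply: sumr_ge0.
  by move=> k /andP[nk _]; apply: c0; lia.
have Acv : cvgn A.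
  by apply: nondecreasing_is_cvgn => //; exists M => _ [n _ <-]; exact: HM.
have Ale n : A n <= limn A by apply: nondecreasing_cvgn_le.
have [N _ HN] : \forall n \near \oo, `|limn A - A n| <= eps by apply: cvgr_dist_le.
exists N => n m Nn nm.
have := HN n Nn; rewrite /= ler_norml => /andP[_].
by have := Ale m; rewrite (Asplit _ _ nm); lra.
Qed.

Lemma ler_sum_range (R : numDomainType) (F : nat -> R) (P : pred nat) l L A B :
  (forall k, 0 <= F k) ->
  (forall k, (l <= k < L)%N -> P k -> (A <= k < B)%N) ->
  \sum_(l <= k < L | P k) F k <= \sum_(A <= k < B) F k.
Proof.
move=> F0 sub; pose N := maxn L B.
rewrite (@big_nat_widen _ _ _ _ L N) ?leq_maxl// big_geq_mkord.
rewrite (@big_nat_widen _ _ _ _ B N) ?leq_maxr// big_geq_mkord.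
rewrite big_mkcond [leRHS]big_mkcond /=; apply: ler_sum => k _.
case: ifP => [/andP[/andP[Pk kL] lk]|_]; last by case: ifP.
have /andP[Ak kB] : (A <= k < B)%N by apply: sub => //; rewrite lk.
by rewrite kB Ak.
Qed.

(** * Sequences of rest bounded variation *)

Definition weighted_variation (R : realType) (c : nat -> R) (k : nat) : R :=
  `|c k - c k.+1| * k%:R.

Lemma weighted_variation_ge0 (R : realType) (c : nat -> R) k : 0 <= weighted_variation c k.
Proof. exact: mulr_ge0. Qed.

Definition tail_variation_le (R : realType) (c : nat -> R) (V : R) : Prop :=
  forall l m, (1 <= l)%N -> \sum_(l <= k < m) `|c k - c k.+1| <= V * c l.

Lemma RBVS_bound (R : realType) (c : nat -> R) :
  (forall k, (1 <= k)%N -> 0 <= c k) -> RBVS c ->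
  exists V : R, 0 <= V /\ tail_variation_le c V.
Proof.
move=> c0 [_ [V HV]]; exists `|V|; split => // l m l1.
apply: (@le_trans _ _ (V * c l)); last by rewrite ler_wpM2r ?c0// ler_norm.
rewrite -lee_fin; apply: le_trans (HV l l1); rewrite -sumEFin.
exact: nneseries_lim_ge.
Qed.

(** The telescoping sum of the differences from l to m is at most V c_l. *)
Lemma almost_decreasing (R : realType) (c : nat -> R) (V : R) l m :
  tail_variation_le c V -> (1 <= l)%N -> (l <= m)%N -> c m <= (1 + V) * c l.
Proof.
move=> c_var l1 lm; have := c_var l m l1.
have : c l - c m <= \sum_(l <= k < m) `|c k - c k.+1| /\
       c m - c l <= \sum_(l <= k < m) `|c k - c k.+1|.
  rewrite -(subnK lm); elim: (m - l)%N => [|j [IH1 IH2]].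
    by rewrite add0n big_geq// subrr.
  rewrite addSn big_nat_recr ?leq_addl//=.
  have := ler_norm (c (j + l)%N - c (j + l).+1).
  have := ler_norm (- (c (j + l)%N - c (j + l).+1)); rewrite normrN.
  by move=> h1 h2; split; lra.
by move=> [_ h1] h2; lra.
Qed.

(** Since p >= 2, the predecessor of a multiple of p is not a multiple, and it
    dominates its successor up to the factor 1 + V. The proof by induction
    carries the unused credit (1 + V) c_n of a last index n that is not a
    multiple of p. *)
Lemma sum_le_nonmultiples (R : realType) (c : nat -> R) (V : R) p n :
  (forall k, (1 <= k)%N -> 0 <= c k) -> 0 <= V -> tail_variation_le c V ->
  (1 < p)%N ->
  \sum_(1 <= k < n) c k <= (2 + V) * \sum_(1 <= k < n) c k * (~~ (p %| k)%N)%:R.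
Proof.
move=> c_ge0 V_ge0 c_var p1; case: n => [|n]; first by rewrite !big_geq// mulr0.
suff : \sum_(1 <= k < n.+1) c k + (1 + V) * (c n * ((0 < n)%N && ~~ (p %| n)%N)%:R) <=
    (2 + V) * \sum_(1 <= k < n.+1) c k * (~~ (p %| k)%N)%:R.
  apply: le_trans; rewrite lerDl; case: n => [|n] /=; first by rewrite !mulr0.
  by rewrite !mulr_ge0 ?c_ge0// addr_ge0.
elim: n => [|n IH]; first by rewrite !big_geq// !mulr0 addr0.
rewrite !(@big_nat_recr _ _ _ n.+1 1)//=.
have [pn|pn] /= := boolP (p %| n.+1)%N; last first.
  have : 0 <= (1 + V) * (c n * ((0 < n)%N && ~~ (p %| n)%N)%:R).
    case: n {IH pn} => [|n] /=; first by rewrite !mulr0.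
    by rewrite !mulr_ge0 ?c_ge0// addr_ge0.
  by move: IH; rewrite !mulr1; lra.
case: n => [|n] in IH pn *; first by move: pn; rewrite dvdn1; lia.
have pn' : ~~ (p %| n.+1)%N.
  apply/negP => pn'; have : (p %| 1)%N by rewrite -(dvdn_addr _ pn') addn1.
  by rewrite dvdn1; lia.
rewrite pn' /= in IH.
have := almost_decreasing c_var (isT : (1 <= n.+1)%N) (leqnSn _).
by move: IH; rewrite !mulr0 !mulr1; lra.
Qed.

(** Each dyadic block [B, 2B[ contributes at most 2 B V c_B <= 2 V eps. *)
Lemma variation_dyadic (R : realType) (c : nat -> R) (V eps : R) l0 A m :
  0 <= V -> tail_variation_le c V -> (0 < l0)%N ->
  (forall k, (l0 <= k)%N -> c k * k%:R <= eps) ->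
  (l0 <= A)%N ->
  \sum_(A <= k < A * 2 ^ m) weighted_variation c k <= 2 * m%:R * V * eps.
Proof.
move=> V_ge0 c_var l0_gt0 ck_small lA; elim: m => [|m IH].
  by rewrite muln1 big_geq// mulr0 !mul0r.
have A0 : (0 < A)%N by apply: leq_trans lA.
pose B := (A * 2 ^ m)%N.
have AB : (A <= B)%N by rewrite leq_pmulr// expn_gt0.
rewrite expnSr mulnA -/B (@big_cat_nat _ _ _ B)//=; last by rewrite leq_pmulr.
have : \sum_(B <= k < B * 2) weighted_variation c k <= 2 * V * eps.
  apply: (@le_trans _ _ (\sum_(B <= k < B * 2) `|c k - c k.+1| * (B * 2)%:R)).
    rewrite [leLHS]big_nat [leRHS]big_nat; apply: ler_sum => k /andP[_ kB].
    by rewrite ler_wpM2l// ler_nat ltnW.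
  rewrite -mulr_suml.
  have B0 : (0 < B)%N by apply: leq_trans AB.
  have := ler_wpM2r (ler0n _ (B * 2)) (c_var B (B * 2)%N B0).
  move/le_trans; apply; rewrite natrM.
  have := ler_wpM2l V_ge0 (ck_small _ (leq_trans lA AB)); lra.
by rewrite -natr1; move: IH; lra.
Qed.

Lemma eps_ge0 (R : realType) (c : nat -> R) (eps : R) l0 :
  (forall k, (1 <= k)%N -> 0 <= c k) -> (0 < l0)%N ->
  (forall k, (l0 <= k)%N -> c k * k%:R <= eps) -> 0 <= eps.
Proof.
move=> c_ge0 l0_gt0 ck_small; apply: le_trans (ck_small _ (leqnn l0)).
by rewrite mulr_ge0 ?c_ge0.
Qed.

Lemma variation_short (R : realType) (c : nat -> R) (V eps : R) l0 A B m :
  0 <= V -> tail_variation_le c V -> (0 < l0)%N ->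
  (forall k, (l0 <= k)%N -> c k * k%:R <= eps) ->
  (l0 <= A)%N -> (B <= A * 2 ^ m)%N ->
  \sum_(A <= k < B) weighted_variation c k <= 2 * m%:R * V * eps.
Proof.
move=> V0 cV l00 csmall lA BA; apply: le_trans (variation_dyadic m V0 cV l00 csmall lA).
have [AB|/ltnW AB] := leqP A B; last first.
  by rewrite big_geq// sumr_ge0// => k _; exact: weighted_variation_ge0.
rewrite [leRHS](@big_cat_nat _ _ _ B)//= lerDl sumr_ge0// => k _.
exact: weighted_variation_ge0.
Qed.

(** A set of indices that, beyond X = 2^e, spans at most a factor X is covered
    by the intervals [l, l X] and [n1, n1 X], where n1 is its first element
    beyond X; together they meet at most 2 e + 1 dyadic blocks. *)
Lemma variation_level (R : realType) (c : nat -> R) (V eps : R) l0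
    (P : pred nat) e l L :
  (forall k, (1 <= k)%N -> 0 <= c k) ->
  0 <= V -> tail_variation_le c V -> (0 < l0)%N ->
  (forall k, (l0 <= k)%N -> c k * k%:R <= eps) ->
  (l0 <= l)%N ->
  (forall n m, (2 ^ e <= n)%N -> (n <= m)%N -> P n -> P m -> (m <= 2 ^ e * n)%N) ->
  \sum_(l <= k < L | P k) weighted_variation c k <= 2 * (2 * e + 1)%:R * V * eps.
Proof.
move=> c_ge0 V_ge0 cV l00 csmall ll0 spread; pose X := (2 ^ e)%N.
have e0 := eps_ge0 c_ge0 l00 csmall.
have short := variation_short V_ge0 cV l00 csmall.
have w0 := weighted_variation_ge0 c.
have X0 : (0 < X)%N by rewrite expn_gt0.
have l_gt0 : (0 < l)%N by apply: leq_trans ll0.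
rewrite (bigID (fun k => k < X)%N) /=.
have small :
    \sum_(l <= k < L | P k && (k < X)%N) weighted_variation c k <= 2 * e%:R * V * eps.
  apply: le_trans (short _ X e ll0 _); last by rewrite leq_pmull.
  by apply: ler_sum_range => // k /andP[lk _] /andP[_ ->]; rewrite lk.
have large :
    \sum_(l <= k < L | P k && ~~ (k < X)%N) weighted_variation c k <= 2 * e.+1%:R * V * eps.
  pose Q k := [&& (l <= k)%N, (k < L)%N, P k & ~~ (k < X)%N].
  have [[n0 Qn0]|noQ] := pselect (exists n, Q n); last first.
    rewrite big_nat_cond big_pred0; last first.
      move=> k; apply/negP => /andP[/andP[? ?] /andP[? ?]]; apply: noQ.
      by exists k; apply/and4P.
    by rewrite !mulr_ge0.
  have exQ : exists n, Q n by exists n0.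
  pose n1 := ex_minn exQ.
  have [Qn1 n1min] : Q n1 /\ forall k, Q k -> (n1 <= k)%N.
    by rewrite /n1; case: ex_minnP.
  have /and4P[ln1 n1L Pn1 Xn1] := Qn1; rewrite -leqNgt in Xn1.
  apply: le_trans (short n1 (X * n1).+1 e.+1 _ _); last 2 first.
  - exact: leq_trans ln1.
  - rewrite expnS mulnC -/X.
    have : (0 < X * n1)%N by rewrite muln_gt0 X0 (leq_trans l_gt0).
    by nia.
  apply: ler_sum_range => // k /andP[lk kL] /andP[Pk Xk].
  have n1k : (n1 <= k)%N by apply: n1min; apply/and4P.
  by rewrite n1k ltnS spread.
apply: le_trans (lerD small large) _; rewrite -mulrDl -mulrDl -mulrDr -natrD.
by rewrite addnS addnn mul2n addn1.
Qed.

(** * Uniform convergence for odd polynomials *)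

(** The ratio w / x lies in [0, 1], and it is at most the sum of 2^-i over the
    levels i < I with w / x >= 2^-(i+1), up to the cut-off 2^-I. *)
Lemma level_decomposition (R : realFieldType) (w x : R) I : 0 <= w <= x ->
  w <= x / 2 ^+ I + \sum_(0 <= i < I) x / 2 ^+ i * (x <= 2 ^+ i.+1 * w)%R%:R.
Proof.
move=> /andP[w0 wx]; have x0 : 0 <= x := le_trans w0 wx.
have p2 i : 0 < 2 ^+ i :> R by rewrite exprn_gt0.
elim: I => [|I IH]; first by rewrite big_geq// addr0 expr0 divr1.
rewrite big_nat_recr//=; have [_|hn] := boolP (x <= 2 ^+ I.+1 * w).
  rewrite mulr1; apply: le_trans IH _; rewrite (addrC _ (x / 2 ^+ I)) addrA.
  by rewrite lerD2r lerDr divr_ge0// ltW.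
move: hn; rewrite -ltNge => /ltW h; apply: ler_wpDr.
  rewrite addr_ge0 ?mulr0// sumr_ge0// => i _.
  by rewrite mulr_ge0 ?ler0n// divr_ge0// ltW.
by rewrite ler_pdivlMr// mulrC.
Qed.

Lemma sum_arith_geo (R : realFieldType) I :
  \sum_(0 <= i < I) i.+1%:R / 2 ^+ i <= 4 :> R.
Proof.
have p2 i : 0 < 2 ^+ i :> R by rewrite exprn_gt0.
suff -> : \sum_(0 <= i < I) i.+1%:R / 2 ^+ i = 4 - 2 * I.+2%:R / 2 ^+ I :> R.
  by rewrite gerBl divr_ge0 ?mulr_ge0// ltW.
elim: I => [|I IH]; first by rewrite big_geq// expr0; field.
rewrite big_nat_recr//= IH exprS -[I.+3%:R]natr1 -[I.+2%:R]natr1.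
by field; rewrite lt0r_neq0.
Qed.

(** The i-th level set costs O(i + 1) V eps by [variation_level] applied with
    D = 2^(i+1) and X = D^K, and the weights 2^-i make the total bounded. *)
Lemma oscillation_sum (R : realType) (c S : nat -> R) (V eps : R) (l0 K : nat) :
  (forall k, (1 <= k)%N -> 0 <= c k) -> 0 <= V ->
  tail_variation_le c V -> (0 < l0)%N -> (forall k, (l0 <= k)%N -> c k * k%:R <= eps) ->
  (forall k, `|S k| <= k%:R) ->
  (forall D n m : nat, (1 < D)%N -> (D ^ K <= n)%N -> (n <= m)%N ->
    n%:R <= D%:R * `|S n| -> m%:R <= D%:R * `|S m| -> (m <= D ^ K * n)%N) ->
  forall l L, (l0 <= l)%N ->
    \sum_(l <= k < L) `|c k - c k.+1| * `|S k| <= (16 * K + 10)%:R * V * eps.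
Proof.
move=> c0 V0 cV l00 csmall Sk spread l L ll0.
have e0 : 0 <= eps := eps_ge0 c0 l00 csmall.
have l_gt0 : (0 < l)%N by apply: leq_trans ll0.
have p2 i : 0 < 2 ^+ i :> R by rewrite exprn_gt0.
pose P i k := k%:R <= 2 ^+ i.+1 * `|S k|.
have level i :
    \sum_(l <= k < L | P i k) weighted_variation c k <= (4 * K + 2)%:R * V * eps * i.+1%:R.
  have D1 : (1 < 2 ^ i.+1)%N by rewrite -(expn0 2) ltn_exp2l.
  apply: le_trans (variation_level L c0 V0 cV l00 csmall (e := (i.+1 * K)%N) ll0 _) _.
    move=> n m; rewrite expnM => Xn nm Pn Pm; apply: spread => //; rewrite natrX//.
  have VE : 0 <= V * eps by rewrite mulr_ge0.
  have hN : 2 * (2 * (i.+1 * K) + 1)%:R <= (4 * K + 2)%:R * i.+1%:R :> R.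
    by rewrite -!natrM ler_nat; nia.
  by have := ler_wpM2r VE hN; lra.
apply: (@le_trans _ _ (\sum_(l <= k < L) (weighted_variation c k / 2 ^+ L +
    \sum_(0 <= i < L) 2 ^- i * (weighted_variation c k * (P i k)%:R)))).
  apply: ler_sum => k _.
  have := @level_decomposition R `|S k| k%:R L; rewrite normr_ge0 Sk => /(_ isT) h.
  apply: le_trans (ler_wpM2l (normr_ge0 _) h) _.
  rewrite mulrDr mulr_sumr /weighted_variation mulrA lerD2l; apply: ler_sum => i _.
  by rewrite le_eqVlt; apply/orP; left; apply/eqP; rewrite /P; ring.
(* With L levels the remainder is 2^-L times a sum over L dyadic blocks. *)
rewrite big_split /= -mulr_suml exchange_big /=.
apply: (@le_trans _ _ (2 * V * eps + \sum_(0 <= i < L)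
    ((4 * K + 2)%:R * V * eps) * (i.+1%:R / 2 ^+ i))).
  apply: lerD.
    rewrite ler_pdivrMr//.
    apply: le_trans (variation_short V0 cV l00 csmall (B := L) (m := L) ll0 _) _.
      by apply: leq_trans (ltnW (ltn_expl L (ltnSn 1))) _; rewrite leq_pmull.
    rewrite -!mulrA ler_wpM2l// mulrC -!mulrA ler_wpM2l// ler_wpM2l//.
    by rewrite -natrX ler_nat ltnW// ltn_expl.
  apply: ler_sum => i _; rewrite -mulr_sumr mulrA mulrC ler_wpM2r ?invr_ge0 ?(ltW (p2 i))//.
  apply: le_trans (level i); rewrite [leRHS]big_mkcond /=; apply: ler_sum => k _.
  by case: (P i k); rewrite ?mulr1 ?mulr0.
rewrite -mulr_sumr.
have := ler_wpM2l (_ : 0 <= (4 * K + 2)%:R * V * eps) (sum_arith_geo R L).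
rewrite !mulr_ge0// => /(_ isT) h; apply: le_trans (lerD (lexx _) h) _.
by rewrite le_eqVlt; apply/orP; left; apply/eqP; ring.
Qed.

Lemma abel_summation (R : realType) (c S : nat -> R) n m : (n <= m)%N ->
  \sum_(n.+1 <= k < m.+1) c k * (S k - S k.-1) =
  \sum_(n.+1 <= k < m.+1) (c k - c k.+1) * S k + c m.+1 * S m - c n.+1 * S n.
Proof.
move=> nm; rewrite -(subnK nm); elim: (m - n)%N => [|j IH].
  by rewrite add0n !big_geq//; ring.
by rewrite addSn !(@big_nat_recr _ _ _ (j + n).+1)/= ?IH ?ltnS ?leq_addl//; ring.
Qed.

Lemma poly_sin_series_cauchy (R : realType) (c : nat -> R) (F : {poly int}) d :
  (forall k, (1 <= k)%N -> 0 <= c k) -> RBVS c ->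
  (0 < d)%N -> size F = d.+1 -> (forall j, ~~ odd j -> F`_j = 0) ->
  c k * k%:R @[k --> \oo] --> (0 : R) ->
  forall eps : R, 0 < eps -> exists N : nat, forall n m t, (N <= n)%N ->
    (n <= m)%N -> `|\sum_(n.+1 <= k < m.+1) c k * poly_sin F t k| <= eps.
Proof.
move=> c0 crb d0 sF Fodd ck eps e0.
have [V [V0 cV]] := RBVS_bound c0 crb.
have [K HK] := sin_sum_level_spread R d0 sF Fodd.
pose C := (16 * K + 10)%:R * V + 2.
have C0 : 0 < C by rewrite ltr_wpDl// mulr_ge0.
have e1 : 0 < eps / C by rewrite divr_gt0.
have [N _ HN] : \forall k \near \oo, `|0 - c k * k%:R| <= eps / C by apply: cvgr_dist_le.
have csmall k : (N.+1 <= k)%N -> c k * k%:R <= eps / C.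
  by move=> Nk; have := HN k (ltnW Nk); rewrite /= sub0r normrN; apply: le_trans; exact: ler_norm.
exists N.+1 => n m t Nn nm; pose S k := sin_sum F k t.
have Sk k : `|S k| <= k%:R.
  apply: le_trans (ler_norm_sum _ _ _) _.
  apply: (@le_trans _ _ (\sum_(1 <= i < k.+1) 1)); last by rewrite sumr_const_nat subn1.
  by apply: ler_sum => i _; exact: sin_max.
have -> : \sum_(n.+1 <= k < m.+1) c k * poly_sin F t k =
    \sum_(n.+1 <= k < m.+1) c k * (S k - S k.-1).
  apply: eq_big_nat => -[//|k] _; congr (_ * _).
  by rewrite /S /sin_sum (@big_nat_recr _ _ _ k.+1)//= addrAC subrr add0r.
rewrite abel_summation//.
have edge i j : (N.+1 <= i)%N -> (j <= i)%N -> `|c i * S j| <= eps / C.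
  move=> Ni ji; apply: le_trans (csmall i Ni).
  have i0 : (0 < i)%N by apply: leq_trans Ni.
  rewrite normrM ger0_norm ?c0// ler_wpM2l ?c0//.
  by apply: le_trans (Sk j) _; rewrite ler_nat.
have main : `|\sum_(n.+1 <= k < m.+1) (c k - c k.+1) * S k| <=
    (16 * K + 10)%:R * V * (eps / C).
  apply: le_trans (ler_norm_sum _ _ _) _.
  under eq_bigr do rewrite normrM.
  apply: (oscillation_sum c0 V0 cV (l0 := N.+1)) => //.
    by move=> D i j D1 Di ij; exact: HK.
  exact: leq_trans (leqnSn _).
apply: le_trans (ler_normB _ _) _.
apply: (@le_trans _ _ ((16 * K + 10)%:R * V * (eps / C) + eps / C + eps / C)).
  apply: lerD; last by apply: edge => //; exact: leq_trans (leqnSn _).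
  apply: le_trans (ler_normD _ _) _; apply: lerD => //.
  by apply: edge => //; apply: leq_trans Nn _; exact: leq_trans nm (leqnSn _).
rewrite (_ : _ + _ + _ = C * (eps / C)); last by rewrite /C; ring.
by rewrite mulrC divfK// lt0r_neq0.
Qed.

(** Clearing denominators, f(k) x = 2 pi F(k) t with F integral and
    t = x / (2 pi a), and t ranges over all reals. *)
Lemma polynomial_sine_ucvg (R : realType) (c : nat -> R) (alpha : nat) (q : {poly rat}) :
  (forall k, (1 <= k)%N -> 0 <= c k) -> RBVS c -> odd alpha ->
  odd_powers_of_degree alpha q ->
  c k * k%:R @[k --> \oo] --> (0 : R) ->
  sin_series_ucvg c (fun k => ratr q.[k%:R]) [set: R].
Proof.
move=> c0 crb alo [sq qodd] ck.
have [F [a a0 qE]] := rat_poly_scale q.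
have ar0 : a%:~R != 0 :> rat by rewrite intr_eq0.
have aR0 : a%:~R != 0 :> R by rewrite intr_eq0.
have sF : size F = alpha.+1.
  rewrite -sq qE size_scale ?invr_eq0// size_map_poly_id0// intr_eq0 lead_coef_eq0.
  by apply/eqP => F0; move: sq; rewrite qE F0 rmorph0 scaler0 size_poly0.
have Fodd j : ~~ odd j -> F`_j = 0.
  move=> /qodd; rewrite qE coefZ coef_map /= => /eqP.
  by rewrite mulf_eq0 invr_eq0 (negbTE ar0) intr_eq0 => /eqP.
have al0 : (0 < alpha)%N by case: alpha alo {sq sF}.
apply/ucvg_cauchyP => eps e0.
have [N HN] := poly_sin_series_cauchy c0 crb al0 sF Fodd ck e0.
exists N => n m x Nn nm _.
have pi0 : pi != 0 :> R by rewrite lt0r_neq0 ?pi_gt0.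
pose t := x / (2 * pi * a%:~R).
have := HN n m t Nn nm; congr (`|_| <= _).
rewrite /sin_psum (@big_cat_nat _ _ _ n.+1 1 m.+1)//= addrAC subrr add0r.
apply: eq_bigr => k _; congr (_ * sin _).
have -> : q.[k%:R] = a%:~R^-1 * F.[k%:R]%:~R.
  by rewrite qE hornerZ natz -[k%:R in LHS]/((Posz k)%:~R) horner_map.
rewrite rmorphM /= fmorphV !ratr_int /t.
by move: (pi : R) pi0 => p p0; field; rewrite aR0 p0.
Qed.

(** * Even powers at pi/2 and 2pi/3 *)

Lemma sin_residue (R : realType) (w n : nat) (r : bool) (m : int) :
  (1 < w)%N -> (n = r %[mod w])%N ->
  sin (n%:R * (2 * pi / w%:R + 2 * pi * m%:~R)) = r%:R * sin (2 * pi / w%:R) :> R.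
Proof.
move=> w1 nr.
have rw : (r %% w)%N = r :> nat by case: (r); rewrite ?mod0n ?modn_small.
have w0 : w%:R != 0 :> R by rewrite pnatr_eq0 -lt0n ltnW.
have nE : n%:R = (n %/ w)%:R * w%:R + r%:R :> R.
  by rewrite {1}(divn_eq n w) nr rw natrD natrM.
have -> : n%:R * (2 * pi / w%:R + 2 * pi * m%:~R) =
    r%:R * (2 * pi / w%:R) + 2 * pi * ((n %/ w)%N%:Z + n%:Z * m)%:~R :> R.
  rewrite intrD intrM mulrDr [X in X + _ = _](_ : _ =
    r%:R * (2 * pi / w%:R) + 2 * pi * (n %/ w)%:R).
    by move: (pi : R) => p; ring.
  by rewrite nE; move: (pi : R) => p; field.
rewrite sin_addint; case: r {nr rw nE} => /=; first by rewrite !mul1r.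
by rewrite !mul0r sin0.
Qed.

Lemma even_pow_residue (w a k : nat) (r : bool) : (0 < a)%N -> ~~ odd a ->
  (k ^ 2 = r %[mod w] -> k ^ a = r %[mod w])%N.
Proof.
move=> a0 ae kr; rewrite -(odd_double_half a) (negbTE ae) add0n -mul2n expnM.
rewrite -modnXm kr modnXm; case: r {kr}; first by rewrite exp1n.
by rewrite exp0n// half_gt0; case: a a0 ae => [|[]].
Qed.

Lemma square_mod4 k : (k ^ 2 = ~~ (2 %| k) %[mod 4])%N.
Proof.
rewrite -modnXm (_ : (2 %| k) = (2 %| k %% 4))%N; last first.
  by rewrite /dvdn modn_dvdm.
by have := ltn_pmod k (isT : 0 < 4)%N; case: (k %% 4)%N => [|[|[|[|]]]].
Qed.

Lemma square_mod3 k : (k ^ 2 = ~~ (3 %| k) %[mod 3])%N.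
Proof.
rewrite -modnXm (_ : (3 %| k) = (3 %| k %% 3))%N; last first.
  by rewrite /dvdn modn_mod.
by have := ltn_pmod k (isT : 0 < 3)%N; case: (k %% 3)%N => [|[|[|]]].
Qed.

Lemma summable_from_point (R : realType) (c f : nat -> R) (x s : R) (p : nat) :
  (forall k, (1 <= k)%N -> 0 <= c k) -> RBVS c -> (1 < p)%N -> 0 < s ->
  (forall k, sin (f k * x) = (~~ (p %| k)%N)%:R * s) ->
  cvgn (fun L => sin_psum c f L x) -> summable_from1 c.
Proof.
move=> c0 crb p1 s0 fx /cvg_seq_bounded/bounded_fun_has_ubound[M HM].
have [V [V0 cV]] := RBVS_bound c0 crb.
apply/(summable_from1P c0); exists ((2 + V) * (M / s)) => n.
apply: le_trans (sum_le_nonmultiples n c0 V0 cV p1) _.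
rewrite ler_wpM2l ?addr_ge0// ler_pdivlMr//.
case: n => [|n].
  rewrite big_geq// mul0r; apply: le_trans (HM _ (ex_intro2 _ _ 0%N I erefl)).
  by rewrite /sin_psum big_geq.
apply: le_trans (HM _ (ex_intro2 _ _ n I erefl)).
by rewrite /sin_psum mulr_suml; apply: ler_sum => k _; rewrite fx mulrA.
Qed.

Lemma ucvg_pointwise (R : realType) (c f : nat -> R) (E : set R) x :
  sin_series_ucvg c f E -> E x -> cvgn (fun L => sin_psum c f L x).
Proof.
move=> [g cg] Ex.
have sub : [set x] `<=` E by move=> _ ->.
have := uniform_subset_cvg (F := sin_psum c f @ \oo) _ sub cg.
by rewrite uniform_set1 => h; apply: (cvgP (g x)); exact: h.
Qed.

Lemma even_series_summable (R : realType) (c : nat -> R) (alpha : nat) (x : R) (m : int) :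
  (forall k, (1 <= k)%N -> 0 <= c k) -> RBVS c ->
  (0 < alpha)%N -> ~~ odd alpha ->
  x = pi / 2%:R + 2%:R * pi * m%:~R \/ x = 2%:R * pi / 3%:R + 2%:R * pi * m%:~R ->
  cvgn (fun L => sin_psum c (fun k => k%:R ^+ alpha) L x) -> summable_from1 c.
Proof.
move=> c0 crb a0 ae; have pi0 : 0 < pi :> R := pi_gt0 R.
case=> ->.
  apply: (@summable_from_point _ _ _ _ (sin (2 * pi / 4)) 2) => //.
    by apply: sin_gt0_pi; lra.
  move=> k; rewrite -natrX (_ : pi / 2%:R = 2 * pi / 4%:R); last by field.
  by apply: sin_residue => //; apply: even_pow_residue => //; exact: square_mod4.
apply: (@summable_from_point _ _ _ _ (sin (2 * pi / 3)) 3) => //.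
  by apply: sin_gt0_pi; lra.
move=> k; rewrite -natrX.
by apply: sin_residue => //; apply: even_pow_residue => //; exact: square_mod3.
Qed.

Lemma summable_ucvg (R : realType) (c f : nat -> R) (E : set R) :
  (forall k, (1 <= k)%N -> 0 <= c k) -> summable_from1 c -> sin_series_ucvg c f E.
Proof.
move=> c0 sc; apply/ucvg_cauchyP => eps e0.
have [N HN] := summable_tail c0 sc e0.
exists N => n m x Nn nm _; apply: le_trans (HN n m Nn nm).
rewrite /sin_psum (@big_cat_nat _ _ _ n.+1 1 m.+1)//= addrAC subrr add0r.
apply: le_trans (ler_norm_sum _ _ _) _.
rewrite [leLHS]big_nat [leRHS]big_nat; apply: ler_sum => k /andP[nk _].
have ck : 0 <= c k by apply: c0; apply: leq_trans nk.
by rewrite normrM (ger0_norm ck) ler_piMr// sin_max.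
Qed.

Lemma odd_monomial_ucvg (R : realType) (c : nat -> R) (alpha : nat) (E : set R) :
  (forall k, (1 <= k)%N -> 0 <= c k) -> RBVS c -> odd alpha ->
  c k * k%:R @[k --> \oo] --> (0 : R) ->
  sin_series_ucvg c (fun k => k%:R ^+ alpha) E.
Proof.
move=> c0 crb ao ck.
have Xodd : odd_powers_of_degree alpha 'X^alpha.
  split=> [|j jo]; first exact: size_polyXn.
  by rewrite coefXn; case: eqP jo => // ->; rewrite ao.
have /ucvg_cauchyP H := polynomial_sine_ucvg c0 crb ao Xodd ck.
apply/ucvg_cauchyP => eps e0; have [N HN] := H eps e0.
exists N => n m x Nn nm _; have := HN n m x Nn nm Logic.I.
congr (`|_ - _| <= _); apply: eq_bigr => k _; congr (_ * sin (_ * _));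
  by rewrite hornerXn rmorphXn /= ratr_nat.
Qed.

(** * Odd powers near zero *)

(** For n < k <= 2n the phases k^alpha |x| are at least the phase y at k = n, and at
    most 2^alpha y <= gamma^alpha y = pi / gamma <= pi / 2. So all the sines
    have the sign of x and are at least sin y in absolute value. *)
Lemma block_sum_bound (R : realType) (c : nat -> R) (alpha n : nat) (gamma x : R) :
  (forall k, (1 <= k)%N -> 0 <= c k) -> 2 <= gamma -> (0 < n)%N ->
  `|x| = pi / (gamma ^+ alpha.+1 * n%:R ^+ alpha) ->
  sin (pi / gamma ^+ alpha.+1) * \sum_(n.+1 <= k < (2 * n).+1) c k <=
  `|\sum_(n.+1 <= k < (2 * n).+1) c k * sin (k%:R ^+ alpha * x)|.
Proof.
move=> c0 g2 n0 xE; have pi0 : 0 < pi :> R := pi_gt0 R.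
have n0R : 0 < n%:R :> R by rewrite ltr0n.
have g0 : 0 < gamma by lra.
have gp i : 0 < gamma ^+ i by rewrite exprn_gt0.
have np i : 0 < n%:R ^+ i :> R by rewrite exprn_gt0.
have -> : `|\sum_(n.+1 <= k < (2 * n).+1) c k * sin (k%:R ^+ alpha * x)| =
    `|\sum_(n.+1 <= k < (2 * n).+1) c k * sin (k%:R ^+ alpha * `|x|)|.
  have [x0|/ltW x0] := leP 0 x; first by rewrite (ger0_norm x0).
  rewrite -[LHS]normrN -sumrN; congr `|_|; apply: eq_bigr => k _.
  by rewrite (ler0_norm x0) mulrN sinN mulrN.
apply: le_trans (ler_norm _); rewrite mulr_sumr.
rewrite [leLHS]big_nat [leRHS]big_nat; apply: ler_sum => k /andP[nk kn].
rewrite mulrC ler_wpM2l ?c0//; first by apply: leq_trans nk.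
set y := _ / _; have y0 : 0 < y by rewrite divr_gt0.
have kxE : k%:R ^+ alpha * `|x| = y * (k%:R / n%:R) ^+ alpha.
  rewrite xE /y expr_div_n; move: (pi : R) => p; field.
  by rewrite !lt0r_neq0.
have ylow : y <= k%:R ^+ alpha * `|x|.
  rewrite kxE ler_peMr ?(ltW y0)// exprn_ege1// ler_pdivlMr// mul1r ler_nat.
  exact: ltnW.
have yhigh : k%:R ^+ alpha * `|x| <= pi / 2.
  rewrite kxE; apply: (@le_trans _ _ (y * gamma ^+ alpha)).
    rewrite ler_pM2l// lerXn2r ?nnegrE ?divr_ge0 ?(ltW g0)//.
    by apply: le_trans g2; rewrite ler_pdivrMr// -natrM ler_nat.
  rewrite /y exprS invfM mulrA mulrVK ?unitfE ?lt0r_neq0//.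
  by rewrite ler_pM2l// lef_pV2 ?posrE.
rewrite leNgt ltr_sin ?in_itv/= -?leNgt//; first by lra.
by lra.
Qed.

(** Every term of the block n < k <= 2n is at least c_(2n) / (1 + V), which
    controls n c_(2n), and an odd index only loses a further factor. *)
Lemma cvg_of_doubling_bound (R : realType) (c : nat -> R) :
  (forall k, (1 <= k)%N -> 0 <= c k) -> RBVS c ->
  (forall eps : R, 0 < eps -> exists N : nat, forall n, (N <= n)%N ->
     \sum_(n.+1 <= k < (2 * n).+1) c k <= eps) ->
  c k * k%:R @[k --> \oo] --> (0 : R).
Proof.
move=> c0 crb H; have [V [V0 cV]] := RBVS_bound c0 crb.
have V1 : 0 < 1 + V by rewrite ltr_wpDr.
apply/cvgrPdist_le => eps e0.
pose eta := eps / (3 * (1 + V) ^+ 2).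
have eta0 : 0 < eta by rewrite divr_gt0// mulr_gt0// exprn_gt0.
have [N HN] := H _ eta0.
exists (2 * N.+1)%N => // k /= Nk.
pose n := k./2.
have kE : (odd k + 2 * n = k)%N by rewrite mul2n odd_double_half.
have nk : (k <= 2 * n + 1)%N by move: kE; case: odd => /=; lia.
have nk' : (2 * n <= k)%N by move: kE; case: odd => /=; lia.
have n0 : (0 < n)%N by lia.
have Nn : (N <= n)%N by lia.
rewrite sub0r normrN ger0_norm ?mulr_ge0 ?c0//; last by lia.
have ck : c k <= (1 + V) * c (2 * n)%N by apply: (almost_decreasing cV) => //; lia.
have blk : n%:R * c (2 * n)%N <= (1 + V) * eta.
  apply: le_trans (_ : (1 + V) * \sum_(n.+1 <= k < (2 * n).+1) c k <= _); last first.
    by rewrite ler_wpM2l ?(ltW V1)// HN.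
  have -> : n%:R * c (2 * n)%N = \sum_(n.+1 <= k < (2 * n).+1) c (2 * n)%N.
    by rewrite sumr_const_nat mulr_natl; congr (_ *+ _); lia.
  rewrite mulr_sumr [leLHS]big_nat [leRHS]big_nat; apply: ler_sum => i /andP[ni i2n].
  by apply: (almost_decreasing cV) => //; apply: leq_trans ni.
have k3 : k%:R <= 3 * n%:R :> R by rewrite -natrM ler_nat; lia.
have c2n : 0 <= c (2 * n)%N by apply: c0; lia.
apply: (@le_trans _ _ ((1 + V) * c (2 * n)%N * (3 * n%:R))).
  by apply: ler_pM => //; apply: c0; lia.
have -> : eps = 3 * (1 + V) * ((1 + V) * eta).
  by rewrite /eta; field; rewrite lt0r_neq0.
have -> : (1 + V) * c (2 * n)%N * (3 * n%:R) = 3 * (1 + V) * (n%:R * c (2 * n)%N) by ring.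
by rewrite ler_wpM2l// mulr_ge0// ltW.
Qed.

Lemma ucvg_near_zero (R : realType) (c : nat -> R) (alpha : nat) (E : set R)
    (gamma : R) (x : nat -> R) :
  (forall k, (1 <= k)%N -> 0 <= c k) -> RBVS c ->
  2 <= gamma -> discrete_nbhd0 alpha%:R gamma x -> (forall j, E (x j)) ->
  sin_series_ucvg c (fun k => k%:R ^+ alpha) E ->
  c k * k%:R @[k --> \oo] --> (0 : R).
Proof.
move=> c0 crb g2 [N [N1 xE]] Ex /ucvg_cauchyP H.
have pi0 : 0 < pi :> R := pi_gt0 R.
have g0 : 0 < gamma by lra.
pose s := sin (pi / gamma ^+ alpha.+1).
have s0 : 0 < s.
  apply: sin_gt0_pi; rewrite divr_gt0 ?exprn_gt0//= ltr_pdivrMr ?exprn_gt0//.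
  rewrite ltr_pMr//; apply: (@lt_le_trans _ _ gamma); first by lra.
  rewrite exprS ler_peMr ?(ltW g0)// exprn_ege1//; lra.
apply: cvg_of_doubling_bound => // eps e0.
have [M HM] := H (s * eps) (mulr_gt0 s0 e0).
exists (M + N)%N => n Mn.
have n0 : (0 < n)%N by lia.
have xn : `|x (n - N)%N| = pi / (gamma ^+ alpha.+1 * n%:R ^+ alpha).
  rewrite xE subnKC; last by lia.
  by rewrite natr1 !powR_mulrn ?(ltW g0).
rewrite -(ler_pM2l s0); apply: le_trans (block_sum_bound c0 g2 n0 xn) _.
have := HM n (2 * n)%N (x (n - N)%N) _ _ (Ex _).
rewrite /sin_psum (@big_cat_nat _ _ _ n.+1 1 (2 * n).+1)//=; last by lia.
by rewrite addrAC subrr add0r; apply; lia.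
Qed.

Unset Implicit Arguments.

Theorem mainTheorem3 (R : realType) (c : nat -> R)
    (c_ge0 : forall k : nat, (1 <= k)%N -> 0 <= c k) (c_RBVS : RBVS c) :
  [/\ (forall alpha : nat, (0 < alpha)%N -> ~~ odd alpha ->
        cvgn (fun L : nat =>
          sin_psum c (fun k => k%:R ^+ alpha) L (pi / 2%:R)) \/
        cvgn (fun L : nat =>
          sin_psum c (fun k => k%:R ^+ alpha) L (2%:R * pi / 3%:R)) ->
        summable_from1 c),
      (forall (alpha : nat) (q : {poly rat}), odd alpha ->
        odd_powers_of_degree alpha q ->
        c k * k%:R @[k --> \oo] --> (0 : R) ->
        sin_series_ucvg c (fun k => ratr q.[k%:R]) [set: R]),
      (forall (alpha : nat) (E : set R), (0 < alpha)%N -> ~~ odd alpha ->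
        (exists m : int, E (pi / 2%:R + 2%:R * pi * m%:~R) \/
                         E (2%:R * pi / 3%:R + 2%:R * pi * m%:~R)) ->
        (sin_series_ucvg c (fun k => k%:R ^+ alpha) E <-> summable_from1 c)) &
      (forall (alpha : nat) (E : set R), odd alpha ->
        (exists (gamma : R) (x : nat -> R),
          [/\ 2%:R <= gamma, discrete_nbhd0 alpha%:R gamma x &
              forall j : nat, E (x j)]) ->
        (sin_series_ucvg c (fun k => k%:R ^+ alpha) E <->
         c k * k%:R @[k --> \oo] --> (0 : R)))].
Proof.
split.
- move=> alpha a0 ae [h|h].
    apply: (even_series_summable (m := 0) c_ge0 c_RBVS a0 ae _ h).
    by left; rewrite mulr0 addr0.
  apply: (even_series_summable (m := 0) c_ge0 c_RBVS a0 ae _ h).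
  by right; rewrite mulr0 addr0.
- by move=> alpha q ao qd ck; exact: polynomial_sine_ucvg qd ck.
- move=> alpha E a0 ae [m Em]; split; last exact: summable_ucvg.
  move=> ucvg; case: Em => Em.
    apply: (even_series_summable c_ge0 c_RBVS a0 ae _ (ucvg_pointwise ucvg Em)).
    by left.
  apply: (even_series_summable c_ge0 c_RBVS a0 ae _ (ucvg_pointwise ucvg Em)).
  by right.
- move=> alpha E ao [gamma [x [g2 xE Ex]]]; split.
    exact: ucvg_near_zero xE Ex.
  exact: odd_monomial_ucvg.
Qed.
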